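(* Let $n \geq 2$ and $r \geq 1$ be integers. Let $\Sigma_n$ be the symmetric group acting on the right on the $n$-element set $\Sigma_{n-1}\backslash\Sigma_n \cong \{1,\dots,n\}$, and let $\Pi^*_n$ be the $\Sigma_n$-poset of all partitions of this set other than the discrete partition $\widehat 0$ and the indiscrete partition $\widehat 1$. Then the $r$th reduced equivariant Euler characteristic of $\Pi^*_n$ is \[ \widetilde{\chi}_r(\Pi^*_n,\Sigma_n) = \frac{1}{n}(a \ast b_r)(n), \] where $(a\ast b_r)(n) = \sum_{d_1 d_2 = n} a(d_1) b_r(d_2)$ is the Dirichlet convolution of the multiplicative arithmetic functions \[ a(n) = (-1)^{n+1}, \qquad b_r(n) = \prod_p (-1)^{n_p} p^{\binom{n_p}{2}} \binom{r}{n_p}_p , \] with $n = \prod_p p^{n_p}$ the prime factorization of $n$.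
   Context: Partitions of a set are ordered by refinement; $\Sigma_n$ acts on partitions via its action on the underlying set. For a finite poset $P$, $\widetilde\chi(P)$ denotes the reduced Euler characteristic of (the order complex of) $P$, i.e. Euler characteristic minus $1$ (so $\widetilde\chi(\emptyset)=-1$). For a finite group $G$ and finite $G$-poset $\Pi$, $C_r(G)$ is the set of $r$-tuples $X=(x_1,\dots,x_r)$ of pairwise commuting elements of $G$, $\Pi^X$ is the subposet of elements fixed by all $x_i$, and the $r$th reduced equivariant Euler characteristic is $\widetilde\chi_r(\Pi,G) = \frac{1}{|G|}\sum_{X\in C_r(G)} \widetilde\chi(\Pi^X)$. The $p$-binomial coefficient is $\binom{r}{d}_p = \frac{(p^r-1)(p^r-p)\cdots(p^r-p^{d-1})}{(p^d-1)(p^d-p)\cdots(p^d-p^{d-1})}$, the number of $d$-dimensional subspaces of $\mathbf{F}_p^r$ (it is $0$ for $d>r$ and $1$ for $d=0$). *)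

(* Defs.v *)
From HB Require Import structures.
From mathcomp Require Import all_boot all_order all_algebra all_fingroup.

Set Implicit Arguments.
Unset Strict Implicit.
Unset Printing Implicit Defensive.

Import Order.TTheory GRing.Theory Num.Theory.

Local Open Scope ring_scope.


Section EulerCharacteristic.

Context {d : Order.disp_t} {T : finPOrderType d}.
Implicit Types (S c : {set T}).

(* The simplices of the order complex of S are its nonempty chains; a chain
   with k + 1 elements is a k-simplex. *)
Definition is_chain c : bool := [forall x in c, forall y in c, (x >=< y)%O].

Definition order_complex S : {set {set T}} :=
  [set c : {set T} | [&& c != set0, c \subset S & is_chain c]].

Definition euler_char S : int :=
  \sum_(c in order_complex S) (-1) ^+ #|c|.-1.

Definition red_euler_char S : int := euler_char S - 1.

End EulerCharacteristic.

Section EquivariantEulerCharacteristic.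

Context {gT : finGroupType} {d : Order.disp_t} {T : finPOrderType d}.

Definition commuting_tuples (r : nat) (G : {group gT}) : {set r.-tuple gT} :=
  [set X : r.-tuple gT |
    [forall i, tnth X i \in G] &&
    [forall i, forall j,
      (tnth X i * tnth X j == tnth X j * tnth X i)%g]].

Definition eq_red_euler_char (r : nat) (to : {action gT &-> T})
    (S : {set T}) (G : {group gT}) : rat :=
  (#|G|%:R)^-1 *
  \sum_(X in commuting_tuples r G)
     (red_euler_char 'Fix_(S | to)([set x in X])%g)%:~R.

End EquivariantEulerCharacteristic.


Section Partitions.

Variable T : finType.

Record setpart : predArgType :=
  SetPart { blocks :> {set {set T}}; _ : partition blocks [set: T] }.

HB.instance Definition _ := [isSub for blocks].
HB.instance Definition _ := [Finite of setpart by <:].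

Implicit Types P Q R : setpart.

Definition refines P Q : bool :=
  [forall B in blocks P, exists C in blocks Q, B \subset C].

Lemma refinesP P Q :
  reflect (forall B, B \in blocks P ->
             exists2 C, C \in blocks Q & B \subset C)
          (refines P Q).
Proof.
by apply: (iffP forall_inP) => h B /h /exists_inP.
Qed.

Lemma refines_refl : reflexive refines.
Proof. by move=> P; apply/refinesP => B PB; exists B. Qed.

Lemma refines_trans : transitive refines.
Proof.
move=> Q P R /refinesP PQ /refinesP QR; apply/refinesP => B /PQ[C /QR[D RD CD]].
by move=> BC; exists D => //; apply: subset_trans CD.
Qed.

Lemma refines_sub P Q : refines P Q -> refines Q P -> blocks P \subset blocks Q.
Proof.
move=> /refinesP PQ /refinesP QP; apply/subsetP => B PB.
have [C QC BC] := PQ B PB; have [D PD CD] := QP C QC.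
suff BD : B = D by rewrite (_ : B = C) //; apply/eqP; rewrite eqEsubset BC BD.
have /and3P[_ /trivIsetP tP P0] := valP P.
apply/eqP; apply: contraT => /(tP B D PB PD) dBD.
case/negP: P0; suff -> : set0 = B by [].
by apply/esym/eqP; rewrite -subset0 -(disjoint_setI0 dBD) subsetI subxx (subset_trans BC).
Qed.

Lemma refines_anti : antisymmetric refines.
Proof.
move=> P Q /andP[PQ QP]; apply/val_inj/eqP.
by rewrite eqEsubset !refines_sub.
Qed.

Fact setpart_display : Order.disp_t. Proof. exact: (Order.Disp tt tt). Qed.

HB.instance Definition _ :=
  Order.Le_isPOrder.Build setpart_display setpart
    refines_refl refines_anti refines_trans.

Lemma setact2_partition P (s : {perm T}) :
  partition (('P^* )^*%act (blocks P) s) [set: T].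
Proof.
have /and3P[/eqP cP /trivIsetP tP P0] := valP P.
have sI : injective (fun B : {set T} => 'P^*%act B s) by apply: act_inj.
apply/and3P; split.
- apply/eqP/setP => x; rewrite inE; apply/bigcupP.
  have: (s^-1)%g x \in cover (blocks P) by rewrite cP inE.
  case/bigcupP => B PB xB; exists ('P^*%act B s); first exact: imset_f.
  by apply/imsetP; exists ((s^-1)%g x); rewrite //= apermE permKV.
- apply/trivIsetP => _ _ /imsetP[B PB ->] /imsetP[C PC ->].
  rewrite (inj_eq sI) => /(tP _ _ PB PC).
  by rewrite -!setI_eq0 /= /setact -imsetI ?imset_eq0 // => x y _ _; apply: perm_inj.
- apply: contra P0 => /imsetP[B PB] /esym/eqP.
  by rewrite /= /setact imset_eq0 => /eqP <-.
Qed.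

Definition setpart_act P (s : {perm T}) : setpart :=
  SetPart (setact2_partition P s).

Lemma setpart_act1 P : setpart_act P 1%g = P.
Proof. by apply: val_inj; rewrite /= -[setact _ _ _]/(('P^* )^*%act _ _) act1. Qed.

Lemma setpart_actM P (s t : {perm T}) :
  setpart_act P (s * t)%g = setpart_act (setpart_act P s) t.
Proof. by apply: val_inj; exact: (actM (('P^* )^*)%act). Qed.

Canonical setpart_action := TotalAction setpart_act1 setpart_actM.

(* Together with [proper_setparts_acts], this makes [proper_setparts] below a
   poset with an order-preserving action of {perm T}. *)
Lemma setpart_act_le P Q (s : {perm T}) :
  (P <= Q)%O -> (setpart_act P s <= setpart_act Q s)%O.
Proof.
move=> /refinesP PQ; apply/refinesP => _ /imsetP[B /PQ[C QC BC] ->].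
by exists ('P^*%act C s); [exact: imset_f | exact: imsetS].
Qed.

Definition discrete_blocks : {set {set T}} := [set [set x] | x in T].
Definition indiscrete_blocks : {set {set T}} := [set [set: T]].

Definition proper_setparts : {set setpart} :=
  [set P : setpart |
    (blocks P != discrete_blocks) && (blocks P != indiscrete_blocks)].

Lemma proper_setparts_acts :
  [acts [set: {perm T}], on proper_setparts | setpart_action].
Proof.
have dis s : ('P^* )^*%act discrete_blocks s = discrete_blocks.
  rewrite /= /setact -imset_comp; apply/setP => B.
  apply/imsetP/imsetP => -[x _ ->].
    by exists (s x) => //; rewrite /= /setact imset_set1.
  by exists ((s^-1)%g x); rewrite //= /setact imset_set1 /= apermE permKV.
have ind s : ('P^* )^*%act indiscrete_blocks s = indiscrete_blocks.
  rewrite /= /setact imset_set1; congr [set _]; apply/setP => x; rewrite inE.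
  by apply/imsetP; exists ((s^-1)%g x); rewrite //= apermE permKV.
apply/subsetP => s _; rewrite !inE /=; apply/subsetP => P; rewrite !inE.
have sI := act_inj ('P^* )^*%act s.
have -> B : blocks (setpart_act P s) == B = (('P^* )^*%act (blocks P) s == B) by [].
by rewrite -{2}(dis s) -{2}(ind s) !(inj_eq sI).
Qed.

End Partitions.


(* Values at 0 are junk and are not constrained. *)
Definition multiplicative_fun (f : nat -> rat) : Prop :=
  f 1%N = 1 /\
  (forall m n : nat, (0 < m)%N -> (0 < n)%N -> coprime m n ->
     f (m * n)%N = f m * f n).

Definition dirichlet_conv (f g : nat -> rat) (n : nat) : rat :=
  \sum_(d <- divisors n) f d * g (n %/ d)%N.

Definition p_binomial (p r d : nat) : rat :=
  (\prod_(i < d) (p%:R ^+ r - p%:R ^+ i)) /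
  (\prod_(i < d) (p%:R ^+ d - p%:R ^+ i)).

Definition arith_a (n : nat) : rat := (-1) ^+ n.+1.

Definition arith_b (r n : nat) : rat :=
  \prod_(p <- primes n)
     ((-1) ^+ logn p n * p%:R ^+ 'C(logn p n, 2) * p_binomial p r (logn p n)).

(* Main.v *)
From HB Require Import structures.
Require Import Defs.
From mathcomp Require Import all_boot all_order all_algebra all_fingroup.
From mathcomp Require Import ring.
Import Order.TTheory GRing.Theory Num.Theory.
Local Open Scope ring_scope.

Set Implicit Arguments.
Unset Strict Implicit.
Unset Printing Implicit Defensive.

(** Write mu_X for the Moebius function of the lattice of X-invariant
    partitions, so that the reduced Euler characteristic of its proper part is
    mu_X(0, 1), and put e_r(n) = (n / n!) sum_X mu_X(0, 1), X ranging over the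
    commuting r-tuples of S_n.  For a commuting tuple (x, X), Weisner's theorem
    applied to the partition into x-orbits reads
      sum_P mu_(x,X)(0, P) = [x = 1] mu_X(0, 1),
    the sum being over the invariant P whose blocks are permuted transitively
    by x.  If such a P has e blocks of size d, then x restricts to a first
    return y = x^e on a block B, each x_i is x^(c_i) times an extension of some
    w_i commuting with y, and the interval [0, P] is the lattice of partitions
    of B invariant under (y, w).  Counting the data (x, X, P) in terms of
    (y, w, c) gives e_r = e_(r+1) * n^r (Dirichlet convolution).  As e_0 = a (by
    the chromatic polynomial of the complete graph), b_0 is the unit and
    b_r = b_(r+1) * n^r (by the q-Pascal rule), induction on r yields
    e_r = a * b_r. *)

(** * Moebius functions and order complexes *)

Section MoebiusOfPoset.

Context {disp : Order.disp_t} {T : finPOrderType disp}.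
Implicit Types (S c L : {set T}) (x y : T).

(** The empty chain is counted and the sign is that of the cardinality, not of the dimension, so
    this is minus the reduced Euler characteristic and satisfies a simple recursion. *)
Definition chain_sum S : int :=
  \sum_(c : {set T} | (c \subset S) && is_chain c) (-1) ^+ #|c|.

Lemma is_chain0 : is_chain (set0 : {set T}).
Proof. by apply/forall_inP => x; rewrite inE. Qed.

Lemma red_euler_charE S : red_euler_char S = - chain_sum S.
Proof.
rewrite /red_euler_char /chain_sum (bigD1 set0) /=; last first.
  by rewrite sub0set is_chain0.
rewrite cards0 expr0 opprD addrC; congr (_ + _).
rewrite /euler_char -sumrN; apply: eq_big => c.
  by rewrite inE andbC -andbA.
rewrite inE => /andP[c0 _].
by rewrite -{2}(@prednK #|c|) ?exprS ?mulN1r ?opprK ?card_gt0.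
Qed.

Lemma chain_max c : c != set0 -> is_chain c ->
  exists2 x, x \in c & forall y, y \in c -> (y <= x)%O.
Proof.
move=> /set0Pn[x0 x0c] /forall_inP cc.
(* The greatest element is the one with the most elements of [c] below it: any [y] in [c] not below
   [x] lies strictly above it and has a larger down-set. *)
have [x xc xmax] := @arg_maxnP _ x0 (mem c) (fun x => #|[set y in c | (y <= x)%O]|) x0c.
exists x => // y yc.
have /forall_inP/(_ _ yc) := cc x xc.
case/orP => // xy; rewrite -(_ : x = y) //; apply/eqP.
apply: contraT => nxy; have := xmax y yc; rewrite /= leqNgt => /negP[].
apply/proper_card/properP; split.
  by apply/subsetP => z; rewrite !inE => /andP[-> /le_trans]; apply.
by exists y; rewrite !inE yc ?lexx //= le_eqVlt eq_sym (negPf nxy) lt_gtF // lt_neqAle nxy.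
Qed.

(** Nonempty chains are sorted by their greatest element [x]; deleting [x] leaves an arbitrary chain
    strictly below [x] and flips the sign. *)
Lemma chain_sum_rec S :
  chain_sum S = 1 - \sum_(x in S) chain_sum [set y in S | (y < x)%O].
Proof.
rewrite /chain_sum (bigD1 set0) /=; last by rewrite sub0set is_chain0.
rewrite cards0 expr0; congr (_ + _); rewrite -sumrN.
pose top c x := (x \in c) && [forall y in c, (y <= x)%O].
transitivity (\sum_(c : {set T} | [&& c \subset S, is_chain c & c != set0])
   \sum_(x | (x \in S) && top c x) (-1) ^+ #|c| : int).
  apply: eq_big => [c|c /andP[/andP[cS cc] c0]]; first by rewrite andbA.
  have [x xc xmax] := chain_max c0 cc.
  rewrite (big_pred1 x) // => y; rewrite /top /=; apply/idP/eqP.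
    case/and3P => yS yc /forall_inP ymax; apply/eqP.
    by rewrite eq_le xmax ?ymax.
  move=> ->; rewrite (subsetP cS) // xc; apply/forall_inP; exact: xmax.
rewrite (exchange_big_dep (mem S)) /=; last by move=> c x _ /andP[].
apply: eq_bigr => x xS; rewrite -sumrN.
have nx (c : {set T}) : c \subset [set y in S | (y < x)%O] -> x \notin c.
  by move=> cS; apply/negP => /(subsetP cS); rewrite inE ltxx andbF.
rewrite (reindex_onto (fun c => x |: c) (fun c => c :\ x)) /=; last first.
  by move=> c /and3P[_ _ /andP[xc _]]; rewrite setD1K.
apply: eq_big => [c|c /andP[_ /eqP cE]]; last first.
  have xc : x \notin c by rewrite -cE !inE eqxx.
  by rewrite cardsU1 xc exprS mulN1r.
apply/idP/idP.
  case/andP=> /and3P[/and3P[cS cc _] _ /andP[_ /forall_inP cx]] /eqP cE.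
  have xc : x \notin c by rewrite -cE !inE eqxx.
  apply/andP; split.
    apply/subsetP => y yc; rewrite inE (subsetP cS) ?inE ?yc ?orbT //=.
    rewrite lt_neqAle cx ?inE ?yc ?orbT // andbT.
    by apply: contraNneq xc => <-.
  apply/forall_inP => y yc; apply/forall_inP => z zc.
  move/forall_inP: cc => /(_ y); rewrite !inE yc orbT => /(_ isT)/forall_inP.
  by apply; rewrite !inE zc orbT.
case/andP=> cS /forall_inP cc; have xc := nx _ cS.
have cx y : y \in c -> (y < x)%O by move=> /(subsetP cS); rewrite inE => /andP[].
rewrite setU1K // eqxx andbT xS /top !inE eqxx /= subUset sub1set xS /=.
have -> : x |: c != set0 by apply/set0Pn; exists x; rewrite !inE eqxx.
rewrite (subset_trans cS) ?andbT /=; last by apply/subsetP => y; rewrite inE => /andP[].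
apply/andP; split.
  apply/forall_inP => y; rewrite !inE => /predU1P[->|yc];
  apply/forall_inP => z; rewrite !inE => /predU1P[->|zc].
  - exact: comparablexx.
  - by rewrite /Order.comparable (ltW (cx _ zc)) orbT.
  - by rewrite /Order.comparable (ltW (cx _ yc)).
  - by have /forall_inP := cc y yc; apply.
by apply/forall_inP => y; rewrite !inE => /predU1P[->|/cx/ltW].
Qed.

Variable (b : T).

(** Philip Hall's formula for the Moebius number of the interval from [b] to [x] in [L]. The case
    [x = b] is separate because the reduced Euler characteristic of the empty interval is -1. *)
Definition moebius L x : int :=
  if x == b then 1 else red_euler_char [set y in L | (b < y < x)%O].

Hypothesis b_min : forall x, (b <= x)%O.

(** Once the terms [y = b] and [y = x] are isolated, what remains is [chain_sum_rec] for the open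
    interval between [b] and [x]. *)
Lemma moebius_sum L x : b \in L -> x \in L ->
  \sum_(y in L | (y <= x)%O) moebius L y = (x == b)%:R.
Proof.
move=> bL xL; have [->|xb] := eqVneq x b.
  rewrite (big_pred1 b) ?/moebius ?eqxx // => y /=.
  apply/andP/eqP => [[_ yb]|->]; last by rewrite lexx.
  by apply/eqP; rewrite eq_le yb b_min.
rewrite (bigD1 b) /=; last by rewrite bL b_min.
rewrite (bigD1 x) /=; last by rewrite xL lexx.
rewrite {1 2}/moebius eqxx (negPf xb) red_euler_charE chain_sum_rec opprB.
set A := \sum_(x0 in _) _; set B := \sum_(i | _) _.
suff -> : B = - A by rewrite mulr0n; ring.
rewrite /A /B -sumrN; apply: eq_big => y.
  rewrite !inE !lt_neqAle b_min andbT (eq_sym b).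
  by case: (y \in L); case: (y <= x)%O; case: (y == b); case: (y == x).
case/andP=> /andP[/andP[yL yx] yb] ynx.
rewrite /moebius (negPf yb) red_euler_charE; congr (- chain_sum _).
apply/setP => z; rewrite !inE; case: (z \in L) => //=.
case: (b < z)%O => //=; case: (boolP (z < y)%O) => zy; rewrite ?andbF //.
by rewrite (lt_le_trans zy yx).
Qed.

End MoebiusOfPoset.

(** * Set partitions as equivalence relations *)

Section SameBlock.

Variable T : finType.
Implicit Types (P Q : setpart T) (x y z : T) (s : {perm T}) (A : {set {perm T}}).

(** Partitions are handled through this relation rather than through their blocks: refinement
    becomes implication, and invariance under a permutation becomes preservation of the relation. *)
Definition same P x y := pblock P x == pblock P y.

Lemma same_refl P x : same P x x. Proof. exact: eqxx. Qed.

Lemma same_sym P x y : same P x y = same P y x. Proof. exact: eq_sym. Qed.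

Lemma same_trans P y x z : same P x y -> same P y z -> same P x z.
Proof. by rewrite /same => /eqP->. Qed.

Lemma same_left P x y : same P x y -> same P x =1 same P y.
Proof. by rewrite /same => /eqP-> z. Qed.

Lemma same_right P x y : same P x y -> same P ^~ x =1 same P ^~ y.
Proof. by rewrite /same => /eqP-> z. Qed.

Lemma cover_setpart P x : x \in cover P.
Proof. by have /and3P[/eqP-> _ _] := valP P; rewrite inE. Qed.

Lemma trivIset_setpart P : trivIset P.
Proof. by have /and3P[] := valP P. Qed.

Lemma sameE P x y : same P x y = (y \in pblock P x).
Proof. by rewrite /same eq_pblock ?trivIset_setpart ?cover_setpart. Qed.

Lemma pblockE P x : pblock P x = [set y | same P x y].
Proof. by apply/setP => y; rewrite inE sameE. Qed.

Lemma pblock_setpart P x : pblock P x \in blocks P.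
Proof. by rewrite pblock_mem ?cover_setpart. Qed.

Lemma setpart_blockE P (B : {set T}) x : B \in blocks P -> x \in B -> B = pblock P x.
Proof. by move=> PB xB; rewrite (def_pblock (trivIset_setpart P) PB). Qed.

Lemma setpart_block_inh P (B : {set T}) : B \in blocks P -> exists x, x \in B.
Proof.
have /and3P[_ _ P0] := valP P; move=> PB; apply/set0Pn.
by apply: contraNneq P0 => <-.
Qed.

Lemma le_same P Q : (P <= Q)%O <-> forall x y, same P x y -> same Q x y.
Proof.
split=> [/refinesP PQ x y|PQ].
  have [C QC /subsetP BC] := PQ _ (pblock_setpart P x).
  rewrite !sameE => /BC yC; rewrite -(setpart_blockE QC) //.
  by apply: BC; rewrite -sameE same_refl.
apply/refinesP => B PB; have [x xB] := setpart_block_inh PB.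
exists (pblock Q x); first exact: pblock_setpart.
by rewrite (setpart_blockE PB xB); apply/subsetP => y; rewrite -!sameE; apply: PQ.
Qed.

Lemma same_inj P Q : same P =2 same Q -> P = Q.
Proof.
by move=> PQ; apply/eqP; rewrite eq_le; apply/andP; split; apply/le_same => x y; rewrite PQ.
Qed.

Lemma mk_setpart (e : rel T) : equivalence_rel e -> exists P, same P =2 e.
Proof.
move=> eqv; have eqv' : {in [set: T] & &, equivalence_rel e} by move=> x y z _ _ _; apply: eqv.
exists (SetPart (equivalence_partitionP eqv')) => x y.
by rewrite sameE /= pblock_equivalence_partition ?inE.
Qed.

Lemma same_act P s x y : same (setpart_act P s) (s x) (s y) = same P x y.
Proof.
rewrite !sameE.
have PsB : 'P^*%act (pblock P x) s \in blocks (setpart_act P s).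
  exact/imset_f/pblock_setpart.
rewrite -(setpart_blockE (x := s x) PsB); last first.
  by apply/imset_f; rewrite -sameE same_refl.
apply/imsetP/idP => [[z zx]|yx]; last by exists y.
by move/perm_inj ->.
Qed.

Lemma fix_same A P : reflect (forall s, s \in A -> forall x y, same P (s x) (s y) = same P x y)
  (P \in 'Fix_(setpart_action T)(A)%g).
Proof.
apply: (iffP afixP) => PA s sA.
  by move=> x y; rewrite -{1}(PA s sA) same_act.
apply: same_inj => x y; have := same_act P s (s^-1 x)%g (s^-1 y)%g.
by rewrite !permKV => ->; rewrite -(PA s sA) !permKV.
Qed.

Fact discrete_part_key : partition (discrete_blocks T) [set: T].
Proof.
apply/and3P; split.
- by apply/eqP/setP => x; rewrite inE; apply/bigcupP; exists [set x]; rewrite ?inE // imset_f.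
- apply/trivIsetP => _ _ /imsetP[x _ ->] /imsetP[y _ ->] xy.
  by rewrite disjoints1 inE; apply: contraNneq xy => ->.
- by apply/negP => /imsetP[x _] /setP/(_ x); rewrite !inE eqxx.
Qed.

Definition discrete_part : setpart T := SetPart discrete_part_key.

Lemma same_discrete x y : same discrete_part x y = (x == y).
Proof.
have b z : [set z] \in blocks discrete_part by rewrite imset_f.
by rewrite sameE -(setpart_blockE (b x)) !inE // eq_sym.
Qed.

Lemma discrete_part_min P : (discrete_part <= P)%O.
Proof. by apply/le_same => x y; rewrite same_discrete => /eqP->; apply: same_refl. Qed.

Lemma discrete_part_fix A : discrete_part \in 'Fix_(setpart_action T)(A)%g.
Proof. by apply/fix_same => s _ x y; rewrite !same_discrete (inj_eq perm_inj). Qed.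

End SameBlock.

(** * The indiscrete partition and the proper part of the lattice *)

Section IndiscretePartition.

Variables (T : finType) (t0 : T).
Implicit Types (P : setpart T) (A : {set {perm T}}).

Fact indiscrete_part_key : partition (indiscrete_blocks T) [set: T].
Proof.
apply/and3P; split; last 1 first.
- by rewrite inE eq_sym; apply/set0Pn; exists t0.
- by rewrite /cover big_set1.
- by apply/trivIsetP => B C; rewrite !inE => /eqP-> /eqP->; rewrite eqxx.
Qed.

Definition indiscrete_part : setpart T := SetPart indiscrete_part_key.

Lemma same_indiscrete x y : same indiscrete_part x y.
Proof. by rewrite sameE -(@setpart_blockE _ indiscrete_part [set: T]) !inE. Qed.

Lemma indiscrete_part_max P : (P <= indiscrete_part)%O.
Proof. by apply/le_same => x y _; apply: same_indiscrete. Qed.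

Lemma indiscrete_part_fix A : indiscrete_part \in 'Fix_(setpart_action T)(A)%g.
Proof. by apply/fix_same => s _ x y; rewrite !same_indiscrete. Qed.

Lemma eq_indiscrete P : (forall x y, same P x y) -> P = indiscrete_part.
Proof. by move=> Pxy; apply: same_inj => x y; rewrite same_indiscrete Pxy. Qed.

Definition top_moebius A : int :=
  moebius (discrete_part T) 'Fix_(setpart_action T)(A)%g indiscrete_part.

(** The proper invariant partitions form the open interval between bottom and top. With at least two
    points bottom and top differ, so [moebius] is not at its exceptional value. *)
Lemma red_euler_char_proper A : (1 < #|T|)%N ->
  red_euler_char 'Fix_(proper_setparts T | setpart_action T)(A)%g = top_moebius A.
Proof.
move=> T1; rewrite /top_moebius /moebius ifN; last first.
  apply/eqP => /(congr1 (same (T := T))) top_bot.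
  have : (#|[set: T]| <= 1)%N.
    apply/card_le1_eqP => x y _ _; apply/eqP; rewrite eq_sym -same_discrete.
    by rewrite -top_bot same_indiscrete.
  by rewrite cardsT leqNgt T1.
congr red_euler_char; apply/setP => P; rewrite 2!inE andbC; congr (_ && _).
rewrite !lt_neqAle discrete_part_min indiscrete_part_max !andbT inE.
by rewrite (eq_sym (discrete_part T)) -!val_eqE.
Qed.

End IndiscretePartition.

(** * Weisner's theorem for the orbits of a permutation *)

Section Weisner.

Variables (T : finType) (t0 : T).
Implicit Types (P Q : setpart T) (x : {perm T}) (A : {set {perm T}}).

(** Defined for every relation, so that no proof has to be carried along; the discrete partition is
    a default for relations that are not equivalences. *)
Definition part_of (e : rel T) : setpart T :=
  odflt (discrete_part T) [pick P | [forall u, forall v, same P u v == e u v]].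

Lemma same_part_of (e : rel T) : equivalence_rel e -> same (part_of e) =2 e.
Proof.
move=> /mk_setpart[P PE] u v; rewrite /part_of; case: pickP => [Q|/(_ P)/negP[]].
  by move/forallP/(_ u)/forallP/(_ v)/eqP.
by apply/forallP => u'; apply/forallP => v'; rewrite PE.
Qed.

(* The join of [P] with the partition into [x]-orbits; an equivalence relation
   only when [P] is [x]-invariant. *)
Definition orbit_join x P u v := [exists w in porbit x u, same P w v].

Lemma orbit_joinP x P u v :
  reflect (exists i, same P ((x ^+ i)%g u) v) (orbit_join x P u v).
Proof.
apply: (iffP exists_inP) => [[w /porbitP[i ->] Pwv]|[i Pi]]; first by exists i.
by exists ((x ^+ i)%g u) => //; apply: mem_porbit.
Qed.

Lemma same_expg P x i u v : (forall u v, same P (x u) (x v) = same P u v) ->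
  same P ((x ^+ i)%g u) ((x ^+ i)%g v) = same P u v.
Proof. by move=> Px; elim: i => [|i IH]; rewrite ?expg0 ?perm1 // expgSr !permM Px. Qed.

Lemma orbit_join_equiv x P : (forall u v, same P (x u) (x v) = same P u v) ->
  equivalence_rel (orbit_join x P).
Proof.
move=> Px; have refl u : orbit_join x P u u.
  by apply/orbit_joinP; exists 0%N; rewrite expg0 perm1 same_refl.
have trans v u w : orbit_join x P u v -> orbit_join x P v w -> orbit_join x P u w.
  move=> /orbit_joinP[i Pi] /orbit_joinP[j Pj]; apply/orbit_joinP; exists (i + j)%N.
  by rewrite expgD permM; apply: same_trans Pj; rewrite same_expg.
have sym u v : orbit_join x P u v -> orbit_join x P v u.
  (* The natural exponent [#[x] * i - i] stands for the inverse of [x ^+ i]. *)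
  move=> /orbit_joinP[i Pi]; apply/orbit_joinP; exists (#[x]%g * i - i)%N.
  rewrite -(same_expg i _ _ Px) -permM -expgD subnK ?leq_pmull ?order_gt0 //.
  by rewrite expgM expg_order expg1n perm1 same_sym.
move=> u v w; split=> // uv; apply/idP/idP; apply: trans => //; exact: sym.
Qed.

Lemma orbit_join_top x P : (forall u v, same P (x u) (x v) = same P u v) ->
  (part_of (orbit_join x P) == indiscrete_part t0) =
  [forall u, forall v, orbit_join x P u v].
Proof.
move=> Px; apply/eqP/forallP => [J u|J].
  apply/forallP => v.
  by rewrite -(same_part_of (orbit_join_equiv Px)) J same_indiscrete.
apply: eq_indiscrete => u v; rewrite same_part_of; last exact: orbit_join_equiv.
by have /forallP := J u; apply.
Qed.

Variables (A : {set {perm T}}) (x : {perm T}).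
Hypotheses (xA : x \in A) (cxA : forall y, y \in A -> commute x y).

Let L := 'Fix_(setpart_action T)(A)%g.
Let mu := moebius (discrete_part T) L.
Let J P := part_of (orbit_join x P).

Let Jfix P : P \in L -> J P \in L.
Proof.
move=> /fix_same PA; apply/fix_same => y yA u v.
have PJ : same (J P) =2 orbit_join x P.
  exact/same_part_of/orbit_join_equiv/PA.
have xy i : (x ^+ i)%g (y u) = y ((x ^+ i)%g u).
  by rewrite -!permM (commuteX i (commute_sym (cxA yA))).
rewrite !PJ; apply/orbit_joinP/orbit_joinP => -[i Pi]; exists i; move: Pi;
  by rewrite xy PA.
Qed.

(** These are the partitions above the partition into [x]-orbits, that is, the closed elements of
    the closure operator [J] on [L]. *)
Let stable Q := [forall u, same Q u (x u)].

Let J_le P Q : P \in L -> stable Q -> (P <= Q)%O = (J P <= Q)%O.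
Proof.
move=> /fix_same PA /forallP Qx.
have PJ : same (J P) =2 orbit_join x P.
  exact/same_part_of/orbit_join_equiv/PA.
apply/idP/idP => /le_same PQ; apply/le_same => u v.
  rewrite PJ => /orbit_joinP[i /PQ]; apply: same_trans.
  elim: i => [|i IH]; first by rewrite expg0 perm1 same_refl.
  by apply: same_trans IH _; rewrite expgSr permM.
move=> Puv; apply: PQ; rewrite PJ; apply/orbit_joinP; exists 0%N.
by rewrite expg0 perm1.
Qed.

Let J_stable P : P \in L -> stable (J P).
Proof.
move=> /fix_same PA; apply/forallP => u.
rewrite same_part_of; last exact/orbit_join_equiv/PA.
by apply/orbit_joinP; exists 1%N; rewrite expg1 same_refl.
Qed.

(** [J] is a closure operator on [L]. Grouping the [P] below a closed [w] by the value of [J P]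
    splits the vanishing sum of [mu] over the interval below [w] into fibre sums over the closed [v]
    below [w]; by induction those with [v] strictly below [w] vanish, hence so does the fibre over
    [w]. If [x = 1] then [J] is the identity and the fibre over the top is the top alone. *)
Lemma weisner :
  \sum_(P in L | [forall u, forall v, orbit_join x P u v]) mu P =
  if x == 1%g then mu (indiscrete_part t0) else 0.
Proof.
have botL : discrete_part T \in L by apply: discrete_part_fix.
have Jtop P : P \in L ->
    [forall u, forall v, orbit_join x P u v] = (J P == indiscrete_part t0).
  by move=> /fix_same PA; rewrite orbit_join_top //; apply: PA.
rewrite (eq_bigl (fun P => (P \in L) && (J P == indiscrete_part t0))); last first.
  by move=> P /=; case: (boolP (P \in L)) => //= /Jtop.
case: eqP => [x1|/eqP x1].
  rewrite (big_pred1 (indiscrete_part t0)) // => P.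
  apply/andP/eqP => [[PL JP]|->].
    apply: eq_indiscrete => u v; move: JP; rewrite -Jtop //.
    move/forallP/(_ u)/forallP/(_ v)/orbit_joinP => -[i].
    by rewrite x1 expg1n perm1.
  have topL : indiscrete_part t0 \in L by apply: indiscrete_part_fix.
  split=> //; rewrite -Jtop //; apply/forallP => u; apply/forallP => v.
  by apply/orbit_joinP; exists 0%N; rewrite same_indiscrete.
suff Jsum w : w \in L -> stable w -> \sum_(P in L | J P == w) mu P = 0.
  apply: Jsum; first exact: indiscrete_part_fix.
  by apply/forallP => u; rewrite same_indiscrete.
have [k] := ubnP #|[set v | (v < w)%O]|.
elim: k w => // k IH w; rewrite ltnS => wk wL wx.
(* The interval sum vanishes only when [w] is not the bottom; a stable bottom would force
   [x = 1]. *)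
have w0 : w != discrete_part T.
  apply: contraNneq x1 => w0; apply/eqP/permP => u; rewrite perm1.
  by move/forallP/(_ u): wx; rewrite w0 same_discrete eq_sym => /eqP.
have := moebius_sum (@discrete_part_min T) botL wL; rewrite (negPf w0) mulr0n.
rewrite (partition_big J (fun v => [&& v \in L, stable v & (v <= w)%O])) /=; last first.
  by move=> P /andP[PL Pw]; rewrite Jfix // J_stable // -J_le.
rewrite (bigD1 w) ?wL ?wx ?lexx //= [X in _ + X]big1 ?addr0; last first.
  move=> v /andP[/and3P[vL vx vw] nvw].
  rewrite -[RHS](IH v) //.
    apply: eq_bigl => P; case: (boolP (P \in L)) => //= PL.
    by case: eqP => [Jv|]; rewrite ?andbF // (J_le PL wx) Jv vw.
  have vw' : (v < w)%O by rewrite lt_neqAle nvw.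
  apply: leq_trans wk; apply/proper_card/properP.
  split; first by apply/subsetP => z; rewrite !inE => /lt_trans; apply.
  by exists v; rewrite !inE ?ltxx.
move=> sum0; rewrite -[RHS]sum0; apply: eq_bigl => P; case: (boolP (P \in L)) => //= PL.
by case: eqP => [Jv|]; rewrite ?andbF // (J_le PL wx) Jv lexx.
Qed.

End Weisner.

(** * The full partition lattice *)

Section ChromaticPolynomial.

Variables (T : finType) (t0 : T).
Implicit Types (P : setpart T).

Definition block_constant q P : pred {ffun T -> 'I_q} :=
  fun f => [forall u, forall v, same P u v ==> (f u == f v)].

Lemma card_block_constant q P : #|@block_constant q P| = (q ^ #|blocks P|)%N.
Proof.
pose pb t : {B | B \in blocks P} := exist _ (pblock P t) (pblock_setpart P t).
pose phi (G : {ffun {B | B \in blocks P} -> 'I_q}) := [ffun t => G (pb t)].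
have rep (B : {B | B \in blocks P}) : exists t, pb t == B.
  have [t tB] := setpart_block_inh (valP B); exists t.
  by rewrite -val_eqE /= -(setpart_blockE (valP B) tB).
have phiI : injective phi.
  move=> G H /ffunP GH; apply/ffunP => B; have [t /eqP<-] := rep B.
  by have := GH t; rewrite !ffunE.
have -> : (q ^ #|blocks P|)%N = #|[set: {ffun {B | B \in blocks P} -> 'I_q}]|.
  by rewrite cardsT card_ffun card_ord card_sig; congr (_ ^ _)%N; apply: eq_card.
rewrite -(card_imset _ phiI); apply: eq_card => f; apply/forallP/imsetP.
  move=> fP; exists [ffun B => f (xchoose (rep B))]; rewrite ?inE //.
  apply/ffunP => t; rewrite !ffunE; apply/eqP.
  have /forallP/(_ (xchoose (rep (pb t))))/implyP := fP t; apply.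
  by have := xchooseP (rep (pb t)); rewrite -val_eqE /= same_sym.
case=> G _ -> u; apply/forallP => v; apply/implyP => uv; rewrite !ffunE.
by apply/eqP; congr (G _); apply/val_inj/eqP.
Qed.

Let L := 'Fix_(setpart_action T)(set0)%g.
Let mu := moebius (discrete_part T) L.

Let inL P : P \in L. Proof. by apply/fix_same => s; rewrite inE. Qed.

(** A map to [q] colours is constant on the blocks of [P] exactly when [P] refines its kernel [K].
    Exchanging the sums, the sum of [mu] over all [P] below [K] keeps only the maps with discrete
    kernel, which are the injective ones. *)
Lemma chromatic_sum q :
  \sum_P mu P * (q ^ #|blocks P|)%:R = (q ^_ #|T|)%:R.
Proof.
have -> : (q ^_ #|T|)%N = #|[set f : {ffun T -> 'I_q} | injectiveb f]|.
  by rewrite card_inj_ffuns card_ord.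
rewrite -sum1_card natr_sum.
transitivity (\sum_(f : {ffun T -> 'I_q}) \sum_(P | block_constant P f) mu P).
  rewrite (exchange_big_dep predT) //=; apply: eq_bigr => P _.
  by rewrite sumr_const card_block_constant mulr_natr.
rewrite big_mkcond [RHS]big_mkcond /=; apply: eq_bigr => f _.
have eqv : equivalence_rel (fun u v => f u == f v).
  by move=> u v w; split=> // /eqP->.
have kerE := same_part_of eqv; set K := part_of _ in kerE.
rewrite inE (eq_bigl (fun P => (P \in L) && (P <= K)%O)); last first.
  move=> P; rewrite inL /=; apply/forallP/idP => [PK|/le_same PK u].
    by apply/le_same => u v uv; rewrite kerE; have /forallP/(_ v)/implyP := PK u; apply.
  by apply/forallP => v; apply/implyP => /PK; rewrite kerE.
rewrite (moebius_sum (@discrete_part_min T)) //.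
have -> : (K == discrete_part T) = injectiveb f; last by case: injectiveb.
apply/eqP/injectiveP => [K0 u v fuv|fI].
  by apply/eqP; rewrite -same_discrete -K0 kerE fuv.
by apply: same_inj => u v; rewrite kerE same_discrete (inj_eq fI).
Qed.

Lemma ffactE_int q n : (q ^_ n)%:R = \prod_(i < n) (q%:R - i%:R) :> int.
Proof.
elim: n => [|n IH]; first by rewrite ffactn0 big_ord0.
rewrite big_ord_recr /= -IH ffactnSr natrM.
(* For [q < n] the truncated difference [q - n] is not the integer one, but [q ^_ n] is already
   zero. *)
have [nq|qn] := leqP n q; first by rewrite natrB.
by rewrite ffact_small ?mul0r.
Qed.

Lemma poly_eq_nat (p q : {poly int}) : (forall i : nat, p.[i%:R] = q.[i%:R]) -> p = q.
Proof.
move=> pq; apply/eqP; rewrite -subr_eq0; apply: contraT => r0.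
have := @max_poly_roots _ (p - q) [seq (i%:R : int) | i <- iota 0 (size (p - q)%R)] r0.
rewrite size_map size_iota ltnn => -> //.
  by apply/allP => _ /mapP[i _ ->]; rewrite /root hornerD hornerN pq subrr.
by rewrite map_inj_uniq ?iota_uniq // => i j /eqP; rewrite eqr_nat => /eqP.
Qed.

(** Compare coefficients of ['X] in the chromatic polynomial of the complete graph: only the
    indiscrete partition has a single block. *)
Lemma top_moebius_set0 :
  top_moebius t0 set0 = (-1) ^+ #|T|.-1 * (#|T|.-1)`!%:R.
Proof.
pose p := \sum_P mu P *: 'X^#|blocks P| : {poly int}.
have T0 : (0 < #|T|)%N by apply/card_gt0P; exists t0.
have pE : p = \prod_(i < #|T|) ('X - i%:R%:P).
  apply: poly_eq_nat => q; rewrite horner_prod horner_sum.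
  transitivity (\sum_P mu P * (q ^ #|blocks P|)%:R).
    by apply: eq_bigr => P _; rewrite hornerZ hornerXn natrX.
  rewrite chromatic_sum ffactE_int; apply: eq_bigr => i _.
  by rewrite hornerXsubC.
transitivity p`_1.
  rewrite coef_sum (bigD1 (indiscrete_part t0)) //= big1 ?addr0 => [|P Ptop].
    by rewrite coefZ coefXn cards1 eqxx mulr1.
  rewrite coefZ coefXn eq_sym; case: eqP => [/eqP/cards1P[B PB]|_]; last by rewrite mulr0.
  case/eqP: Ptop; apply: eq_indiscrete => u v; apply/eqP.
  have := pblock_setpart P u; have := pblock_setpart P v.
  by rewrite PB !inE => /eqP-> /eqP->.
(* The factor for [i = 0] is ['X], so the coefficient sought is the value at 0 of the remaining
   product. *)
rewrite pE; case: #|T| T0 => // n _; rewrite big_ord_recl /= subr0 coefXM /= -horner_coef0 horner_prod.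
rewrite (eq_bigr (fun i : 'I__ => (-1) * i.+1%:R)) => [|i _]; last first.
  by rewrite hornerXsubC sub0r mulN1r.
rewrite big_split /= prodr_const card_ord fact_prod natr_prod big_add1 /=.
by rewrite big_mkord.
Qed.

End ChromaticPolynomial.

(** * Partitions whose blocks are permuted cyclically *)

Section MoebiusIsomorphism.

Context {d1 d2 : Order.disp_t} {T1 : finPOrderType d1} {T2 : finPOrderType d2}.
Variables (b1 : T1) (b2 : T2) (L1 : {set T1}) (L2 : {set T2}).
Hypotheses (b1_min : forall x, (b1 <= x)%O) (b2_min : forall x, (b2 <= x)%O).
Hypotheses (b1L : b1 \in L1) (b2L : b2 \in L2).
Variables (f : T1 -> T2) (g : T2 -> T1) (p : T1).
Hypothesis fL : forall x, x \in L1 -> (x <= p)%O -> f x \in L2.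
Hypothesis gL : forall y, y \in L2 -> [/\ g y \in L1, (g y <= p)%O & f (g y) = y].
Hypothesis f_le : forall x y, x \in L1 -> (x <= p)%O -> y \in L1 -> (y <= p)%O ->
  (f x <= f y)%O = (x <= y)%O.

(** The map [f] is an isomorphism, with inverse [g], from the part of [L1] below [p] onto [L2], and
    it sends bottom to bottom. Moebius numbers are determined by the recursion [moebius_sum], which
    [f] transports. *)
Lemma moebius_iso x : x \in L1 -> (x <= p)%O -> moebius b1 L1 x = moebius b2 L2 (f x).
Proof.
have fI x' y : x' \in L1 -> (x' <= p)%O -> y \in L1 -> (y <= p)%O ->
    f x' = f y -> x' = y.
  move=> xL xp yL yp fxy; apply/eqP; rewrite eq_le.
  by rewrite -(f_le xL xp yL yp) -(f_le yL yp xL xp) fxy lexx.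
have [k] := ubnP #|[set y | (y < x)%O]|.
elim: k x => // k IH x; rewrite ltnS => xk xL xp.
have fb : (f x == f b1) = (x == b1).
  by apply/eqP/eqP => [|->] //; apply: fI.
have fb1 : f b1 = b2.
  have [gb gp fgb] := gL b2L; apply/eqP; rewrite eq_le b2_min andbT.
  by rewrite -[X in (_ <= X)%O]fgb f_le.
have := moebius_sum b1_min b1L xL.
rewrite -fb fb1 -(moebius_sum b2_min b2L (fL xL xp)).
rewrite (bigD1 x) ?xL ?lexx //= [in RHS](bigD1 (f x)) ?fL ?lexx //=.
set S1 := \sum_(i | _) _; set S2 := \sum_(i | _) _.
suff -> : S1 = S2 by move/addIr.
transitivity (\sum_(i | (i \in L1) && (i <= x)%O && (i != x)) moebius b2 L2 (f i)).
  apply: eq_bigr => y /andP[/andP[yL yx] ynx]; apply: IH => //; last exact: le_trans xp.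
  apply: leq_trans xk; apply/proper_card/properP.
  have yx' : (y < x)%O by rewrite lt_neqAle ynx.
  split; first by apply/subsetP => z; rewrite !inE => /lt_trans; apply.
  by exists y; rewrite !inE ?ltxx.
rewrite /S2 [RHS](reindex_onto f g) /=; last first.
  by move=> y /andP[/andP[/gL[]]].
apply: eq_bigl => y; apply/andP/andP => [[/andP[yL yx] ynx]|].
  have yp := le_trans yx xp; have fy := fL yL yp; have [gy gp fg] := gL fy.
  split; last by apply/eqP; apply: fI.
  by rewrite fy f_le // yx; apply: contraNneq ynx => /fI->.
case=> /andP[/andP[fyL fyx] nfyx] /eqP gf; have [gy gp fg] := gL fyL.
rewrite gf in gy gp; rewrite gy -f_le //; split=> //.
by apply: contraNneq nfyx => ->.
Qed.

End MoebiusIsomorphism.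

(** * Families of commuting elements *)

Definition commuting_family (gT : finGroupType) r (X : {ffun 'I_r -> gT}) :=
  [forall i, forall k, X i * X k == X k * X i]%g.

Definition centralizing_family (gT : finGroupType) r (x : gT) (X : {ffun 'I_r -> gT}) :=
  commuting_family X && [forall i, x * X i == X i * x]%g.

Definition family_set (gT : finGroupType) r (x : gT) (X : {ffun 'I_r -> gT}) :=
  x |: [set X i | i : 'I_r].

Lemma centralizing_familyP (gT : finGroupType) r (x : gT) (X : {ffun 'I_r -> gT}) :
  reflect ((forall i k, commute (X i) (X k)) /\ (forall i, commute x (X i)))
          (centralizing_family x X).
Proof.
apply: (iffP andP) => -[cX xX]; split; last 2 first.
- by apply/forallP => i; apply/forallP => k; apply/eqP/cX.
- by apply/forallP => i; apply/eqP/xX.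
- by move=> i k; have /forallP/(_ k)/eqP := forallP cX i.
- by move=> i; have /eqP := forallP xX i.
Qed.

Lemma family_setP (gT : finGroupType) r (x : gT) (X : {ffun 'I_r -> gT}) (Q : gT -> Prop) :
  (forall s, s \in family_set x X -> Q s) <-> Q x /\ forall i, Q (X i).
Proof.
split=> [QX|[Qx QX] s /setU1P[-> //|/imsetP[i _ ->]]]; last exact: QX.
by split=> [|i]; apply: QX; rewrite !inE ?eqxx ?imset_f ?orbT.
Qed.

Lemma same_pull (T D : finType) (Q : setpart T) (f : D -> T) :
  equivalence_rel (fun u v => same Q (f u) (f v)).
Proof. by move=> u v w; split=> [|/same_left->]; rewrite ?same_refl. Qed.

(** * First return to a block, and permutations commuting with the cycle *)

Section FirstReturn.

Variables (T D : finType).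

(* [g] identifies [D] with a block [B] of [P], the translates of [B] under the
   powers [x ^+ i], [i < e], are the blocks of [P], and the first return
   [x ^+ e] of [x] to [B] acts on [D] as [y]. *)
Definition framed (x : {perm T}) (P : setpart T) (g : D -> T) (e : nat) (y : {perm D}) :=
  [/\ injective g,
      forall i i' j j', (i < e)%N -> (i' < e)%N ->
        same P ((x ^+ i)%g (g j)) ((x ^+ i')%g (g j')) = (i == i'),
      forall t, exists p : D * 'I_e, t = (x ^+ p.2)%g (g p.1) &
      forall j, (x ^+ e)%g (g j) = g (y j)].

Variables (t0 : T) (j0 : D) (x : {perm T}) (P : setpart T) (g : D -> T) (e : nat) (y : {perm D}).
Hypothesis fr : framed x P g e y.

Lemma framed_gt0 : (0 < e)%N.
Proof. by have [_ _ /(_ t0)[[_ i] _] _] := fr; case: e i => // -[]. Qed.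

(** Each full turn of [e] steps returns to the framed block and acts there as [y]. *)
Lemma framed_mod n j : (x ^+ n)%g (g j) = (x ^+ (n %% e))%g (g ((y ^+ (n %/ e))%g j)).
Proof.
have [_ _ _ ret] := fr.
have xe q : (x ^+ (q * e))%g (g j) = g ((y ^+ q)%g j).
  elim: q => [|q IH]; first by rewrite !expg0 !perm1.
  by rewrite mulSnr expgD permM IH ret expgSr permM.
by rewrite {1}(divn_eq n e) expgD permM xe.
Qed.

Lemma framed_same n m j j' :
  same P ((x ^+ n)%g (g j)) ((x ^+ m)%g (g j')) = (n == m %[mod e]).
Proof.
have [_ sameP _ _] := fr.
by rewrite (framed_mod n) (framed_mod m) sameP ?ltn_mod ?framed_gt0.
Qed.

Lemma framed_inj i i' j j' : (i < e)%N -> (i' < e)%N ->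
  (x ^+ i)%g (g j) = (x ^+ i')%g (g j') -> i = i' /\ j = j'.
Proof.
have [gI sameP _ _] := fr => ie i'e E.
have ii' : i = i' by apply/eqP; rewrite -(sameP _ _ j j') // E same_refl.
by split=> //; move: E; rewrite ii' => /perm_inj/gI.
Qed.

Let cycleD n m t : (x ^+ n)%g ((x ^+ m)%g t) = (x ^+ (m + n))%g t.
Proof. by rewrite expgD permM. Qed.

Let cycleS n t : x ((x ^+ n)%g t) = (x ^+ n.+1)%g t.
Proof. by rewrite expgSr permM. Qed.

Lemma framed_cycle u v : same P (x u) (x v) = same P u v.
Proof.
have [_ _ surj _] := fr.
have [[j i] ->] := surj u; have [[j' i'] ->] := surj v; rewrite /=.
by rewrite !cycleS !framed_same -[i.+1]addn1 -[i'.+1]addn1 eqn_modDr.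
Qed.

(** The pairs [(j, i)], read as [(x ^+ i) (g j)], are coordinates on all of [T]: a point of the
    frame and the index of a translate. *)
Fact framed_coordinates :
  {h : T -> D * 'I_e | forall t, (x ^+ (h t).2)%g (g (h t).1) = t
                     & forall j (i : 'I_e), h ((x ^+ i)%g (g j)) = (j, i)}.
Proof.
have surj t : exists p : D * 'I_e, t == (x ^+ p.2)%g (g p.1).
  by have [_ _ /(_ t)[p ->] _] := fr; exists p.
exists (fun t => xchoose (surj t)) => [t|j i].
  by rewrite -(eqP (xchooseP (surj t))).
have /eqP := xchooseP (surj ((x ^+ i)%g (g j))); case: (xchoose _) => j' i' /=.
by case/framed_inj=> // /val_inj -> ->.
Qed.

Let h := s2val framed_coordinates.
Let hE t : (x ^+ (h t).2)%g (g (h t).1) = t.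
Proof. by rewrite /h; case: framed_coordinates. Qed.
Let hK j (i : 'I_e) : h ((x ^+ i)%g (g j)) = (j, i).
Proof. by rewrite /h; case: framed_coordinates. Qed.

Fact spread_inj (w : {perm D}) : injective (fun t => (x ^+ (h t).2)%g (g (w (h t).1))).
Proof.
move=> u v /framed_inj[] // /val_inj e2 /perm_inj e1.
by rewrite -(hE u) -(hE v) e1 e2.
Qed.

(** In coordinates, [(j, i)] first goes to [(w j, i)], then is moved by [x ^+ c]. When [w] commutes
    with [y], copying [w] to every translate is compatible with the return map, so the result
    commutes with [x]. *)
Definition spread (w : {perm D}) (c : 'I_e) : {perm T} := (perm (@spread_inj w) * x ^+ c)%g.

Lemma spreadE w c n j : commute y w ->
  spread w c ((x ^+ n)%g (g j)) = (x ^+ (n + c))%g (g (w j)).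
Proof.
move=> yw; have ne : (n %% e < e)%N by rewrite ltn_mod framed_gt0.
rewrite permM permE (framed_mod n j) [h _](hK _ (Ordinal ne)) /=.
by rewrite expgD permM (framed_mod n) -!permM (commuteX (n %/ e) (commute_sym yw)).
Qed.

Lemma perm_framed (s s' : {perm T}) :
  (forall (i : 'I_e) j, s ((x ^+ i)%g (g j)) = s' ((x ^+ i)%g (g j))) -> s = s'.
Proof. by move=> ss'; apply/permP => t; rewrite -(hE t). Qed.

Lemma spread_commute_cycle w c : commute y w -> commute x (spread w c).
Proof.
move=> yw; move: (spread w c) (fun n j => spreadE c n j yw) => s sE.
by apply: perm_framed => i j; rewrite !permM (cycleS i) !sE cycleS.
Qed.

(** The powers of [x] commute with both permutations, so only the action on the frame matters. *)
Lemma spread_commute w c w' c' : commute y w -> commute y w' ->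
  commute (spread w c) (spread w' c') <-> commute w w'.
Proof.
move=> yw yw'.
move: (spread w c) (fun n j => spreadE c n j yw) => s sE.
move: (spread w' c') (fun n j => spreadE c' n j yw') => s' s'E.
split=> [/permP E|ww'].
  apply/permP => j; have [gI _ _ _] := fr.
  have := E ((x ^+ 0)%g (g j)); rewrite !permM !(sE, s'E).
  by rewrite !add0n addnC => /perm_inj/gI.
apply: perm_framed => i j; rewrite !permM !(sE, s'E) addnAC.
by rewrite -!permM ww'.
Qed.

Lemma spread_same w c u v : commute y w ->
  same P (spread w c u) (spread w c v) = same P u v.
Proof.
move=> yw; rewrite -(hE u) -(hE v) !spreadE // !framed_same.
by rewrite eqn_modDr.
Qed.

Lemma spread_injective w c w' c' : commute y w -> commute y w' ->
  spread w c = spread w' c' -> w = w' /\ c = c'.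
Proof.
move=> yw yw' /permP E.
have E' j : w j = w' j /\ c = c'.
  have := E ((x ^+ 0)%g (g j)); rewrite !spreadE // !add0n.
  by case/framed_inj=> // /val_inj.
by split; [apply/permP => j; case: (E' j) | case: (E' j0)].
Qed.

(** Since [z] permutes the blocks and commutes with [x], it shifts all translates by the same amount
    [c], read off from the block of [z (g j0)]. Undoing this shift on the frame leaves [w], which
    commutes with [y] because [z] commutes with [x ^+ e]. *)
Lemma spread_surj (z : {perm T}) : commute x z ->
  (forall u v, same P (z u) (z v) = same P u v) ->
  exists w : {perm D}, exists2 c, commute y w & z = spread w c.
Proof.
move=> xz Pz; pose c := (h (z (g j0))).2.
have gI : injective g by case: fr.
have zg j : (x ^+ c)%g (g (h (z (g j))).1) = z (g j).
  rewrite -[RHS]hE; suff -> : c = (h (z (g j))).2 by [].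
  have : same P (z (g j0)) (z (g j)).
    by rewrite Pz -[g j0](perm1 (g j0)) -[g j](perm1 (g j)) -[1%g](expg0 x) framed_same.
  rewrite -{1}(hE (z (g j0))) -{1}(hE (z (g j))) framed_same.
  by rewrite !modn_small // => /eqP/val_inj.
have wI : injective (fun j => (h (z (g j))).1).
  by move=> j j' /= E; apply/gI/(@perm_inj _ z); rewrite -(zg j) -(zg j') E.
have zx n t : z ((x ^+ n)%g t) = (x ^+ n)%g (z t).
  by rewrite -!permM (commuteX n (commute_sym xz)).
pose w := perm wI; have zw j : z (g j) = (x ^+ c)%g (g (w j)) by rewrite permE zg.
have yw : commute y w.
  apply/permP => j; rewrite !permM; apply/gI/(@perm_inj _ (x ^+ c)%g).
  have [_ _ _ ret] := fr.
  by rewrite -zw -!ret zx zw !cycleD addnC.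
exists w; exists c => //; apply: perm_framed => i j.
by rewrite spreadE // zx zw cycleD addnC.
Qed.

Section Families.

Variable r : nat.
Implicit Types (w : {ffun 'I_r -> {perm D}}) (c : {ffun 'I_r -> 'I_e}).

Definition spread_family (u : {ffun 'I_r -> {perm D}} * {ffun 'I_r -> 'I_e}) :
    {ffun 'I_r -> {perm T}} :=
  [ffun k => spread (u.1 k) (u.2 k)].

Lemma spread_family_centralizing w c : centralizing_family y w ->
  centralizing_family x (spread_family (w, c)).
Proof.
case/centralizing_familyP=> ww yw; apply/centralizing_familyP; split=> [i k|i].
  by rewrite !ffunE; apply/(spread_commute _ _ (yw i) (yw k)).
by rewrite ffunE; apply: spread_commute_cycle.
Qed.

Lemma spread_family_fix w c : centralizing_family y w ->
  P \in 'Fix_(setpart_action T)(family_set x (spread_family (w, c)))%g.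
Proof.
case/centralizing_familyP=> ww yw; apply/fix_same/family_setP; split.
  exact: framed_cycle.
by move=> i u v; rewrite ffunE; apply: spread_same.
Qed.

Lemma spread_family_inj :
  {in [pred u | centralizing_family y u.1] &, injective spread_family}.
Proof.
move=> [w c] [w' c'] /centralizing_familyP[_ yw] /centralizing_familyP[_ yw'] /ffunP E.
suff EE i : w i = w' i /\ c i = c' i.
  by congr (_, _); apply/ffunP => i; case: (EE i).
by have := E i; rewrite !ffunE; apply: spread_injective; [apply: yw | apply: yw'].
Qed.

Lemma spread_family_surj X : centralizing_family x X ->
  P \in 'Fix_(setpart_action T)(family_set x X)%g ->
  exists2 u, centralizing_family y u.1 & X = spread_family u.
Proof.
case/centralizing_familyP=> XX xX /fix_same/family_setP[_ PX].
have ex i : exists u : {perm D} * 'I_e, (y * u.1 == u.1 * y)%g && (X i == spread u.1 u.2).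
  by have [w [c /eqP yw /eqP Xi]] := spread_surj (xX i) (PX i); exists (w, c); apply/andP.
pose u i := xchoose (ex i).
have uP i : commute y (u i).1 /\ X i = spread (u i).1 (u i).2.
  by have /andP[/eqP yu /eqP Xi] := xchooseP (ex i).
exists ([ffun i => (u i).1], [ffun i => (u i).2]); last first.
  by apply/ffunP => i; rewrite !ffunE; case: (uP i).
apply/centralizing_familyP; split=> [i k|i]; rewrite !ffunE; last by case: (uP i).
have [[yi Xi] [yk Xk]] := (uP i, uP k).
by apply/(spread_commute (u i).2 (u k).2 yi yk); rewrite -Xi -Xk.
Qed.

Let spread_part (R : setpart D) : setpart T :=
  part_of (fun u v => ((h u).2 == (h v).2) && same R (h u).1 (h v).1).

Let spread_partE R u v :
  same (spread_part R) u v = ((h u).2 == (h v).2) && same R (h u).1 (h v).1.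
Proof.
rewrite same_part_of // => {u v} u v t.
split=> [|/andP[/eqP-> /same_left->] //]; by rewrite eqxx same_refl.
Qed.

(** Reducing [i + n] modulo [e] applies a power of [y] on the frame. The powers for [i] and [i']
    need only agree when [i = i'], and then the invariance of [R] under [y] absorbs them. *)
Let spread_part_shift R n (i i' : 'I_e) j j' :
  (forall a b, same R (y a) (y b) = same R a b) ->
  same (spread_part R) ((x ^+ (i + n))%g (g j)) ((x ^+ (i' + n))%g (g j')) =
  (i == i') && same R j j'.
Proof.
move=> yR; have lt k : (k %% e < e)%N by rewrite ltn_mod framed_gt0.
rewrite (framed_mod (i + n)) (framed_mod (i' + n)) spread_partE.
rewrite (hK _ (Ordinal (lt (i + n)%N))) (hK _ (Ordinal (lt (i' + n)%N))) /=.
rewrite -val_eqE /= eqn_modDr !modn_small // val_eqE.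
by have [->|//] := eqVneq i i'; rewrite same_expg.
Qed.

(** Restriction to the frame identifies the invariant partitions below [P] with the partitions of
    [D] invariant under [y] and [w]; the inverse copies a partition to every translate. [P] itself
    restricts to the indiscrete partition. *)
Lemma spread_moebius w c : centralizing_family y w ->
  moebius (discrete_part T) 'Fix_(setpart_action T)(family_set x (spread_family (w, c)))%g P
  = top_moebius j0 (family_set y w).
Proof.
move=> yw; have PL := spread_family_fix c yw.
have /centralizing_familyP[_ yw'] := yw.
have e0 := framed_gt0; pose i0 := Ordinal e0.
have ret j : (x ^+ e)%g (g j) = g (y j) by case: fr.
pose rho (Q : setpart T) := part_of (fun j j' : D => same Q (g j) (g j')).
have rhoE Q j j' : same (rho Q) j j' = same Q (g j) (g j').
  exact/same_part_of/same_pull.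
set L1 := 'Fix_(_)(_)%g in PL *; pose L2 := 'Fix_(setpart_action D)(family_set y w)%g.
transitivity (moebius (discrete_part D) L2 (rho P)); last first.
  rewrite /top_moebius -/L2; congr moebius; apply: eq_indiscrete => j j'.
  by rewrite rhoE; have := framed_same 0 0 j j'; rewrite expg0 !perm1 eqxx.
apply: (moebius_iso (L1 := L1) (L2 := L2) (f := rho) (g := spread_part) (p := P)
  (@discrete_part_min T) (@discrete_part_min D)
  (discrete_part_fix _) (discrete_part_fix _)) => //.
- move=> Q /fix_same/family_setP[Qx QX] _; apply/fix_same/family_setP.
  split=> [j j'|k j j']; rewrite !rhoE; first by rewrite -!ret same_expg.
  rewrite -(QX k (g j)) ffunE -(same_expg (c k) (g (w k j)) _ Qx) /=.
  have sg u : spread (w k) (c k) (g u) = (x ^+ c k)%g (g (w k u)).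
    by have := spreadE (c k) 0 u (yw' k); rewrite expg0 perm1.
  by rewrite !sg.
- move=> R /fix_same/family_setP[Ry Rw]; split.
  + apply/fix_same/family_setP; split=> [u v|k u v]; rewrite -(hE u) -(hE v).
      rewrite !cycleS -[(h u).2.+1]addn1 -[(h v).2.+1]addn1 spread_part_shift //.
      by rewrite -[X in same _ ((x ^+ X)%g _)]addn0 -[X in same _ _ ((x ^+ X)%g _)]addn0 spread_part_shift.
    rewrite ffunE !spreadE // spread_part_shift // Rw.
    by rewrite -[X in same _ ((x ^+ X)%g _)]addn0 -[X in same _ _ ((x ^+ X)%g _)]addn0 spread_part_shift.
  + apply/le_same => u v; rewrite spread_partE => /andP[/eqP uv _].
    by rewrite -(hE u) -(hE v) framed_same uv.
  + apply: same_inj => j j'; rewrite rhoE.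
    by have := @spread_part_shift R 0 i0 i0 j j' Ry; rewrite addn0 expg0 !perm1 eqxx.
move=> Q Q' /fix_same/family_setP[Qx _] /le_same QP /fix_same/family_setP[Q'x _] _.
apply/idP/idP => /le_same QQ'; apply/le_same => u v; last by rewrite !rhoE; apply: QQ'.
(* Two points in the same block of [Q] lie in the same translate, since [Q] refines [P]; invariance
   under [x] moves them both back to the frame. *)
move=> Quv; have := QP _ _ Quv; move: Quv; rewrite -(hE u) -(hE v) framed_same.
move=> Quv; rewrite !modn_small // => /eqP/val_inj uv; move: Quv.
by rewrite uv !same_expg // -!rhoE; apply: QQ'.
Qed.

(** The families summed over are exactly the spreads of families [w] centralizing [y]. The Moebius
    number does not depend on the [r] shifts, which are free in ['I_e]: hence the factor [e ^ r]. *)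
Lemma framed_sum :
  \sum_(X : {ffun 'I_r -> {perm T}} | centralizing_family x X &&
            (P \in 'Fix_(setpart_action T)(family_set x X)%g))
     moebius (discrete_part T) 'Fix_(setpart_action T)(family_set x X)%g P
  = (e ^ r)%:R *
    \sum_(w : {ffun 'I_r -> {perm D}} | centralizing_family y w) top_moebius j0 (family_set y w).
Proof.
transitivity (\sum_(X : {ffun 'I_r -> {perm T}} |
      X \in [set spread_family u | u in [pred u | centralizing_family y u.1]])
    moebius (discrete_part T) 'Fix_(setpart_action T)(family_set x X)%g P).
  apply: eq_bigl => X; apply/andP/imsetP => [[cX PX]|[[w c] yw ->]].
    by have [u yu Xu] := spread_family_surj cX PX; exists u.
  by rewrite spread_family_centralizing ?spread_family_fix.
rewrite big_imset /=; last exact: spread_family_inj.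
transitivity (\sum_(w : {ffun 'I_r -> {perm D}} | centralizing_family y w)
    \sum_(c : {ffun 'I_r -> 'I_e}) top_moebius j0 (family_set y w)).
  rewrite pair_big /=; apply: eq_big => [[w c]|[w c] yw]; first by rewrite inE andbT.
  exact: spread_moebius.
rewrite mulr_sumr; apply: eq_bigr => w _.
by rewrite sumr_const card_ffun !card_ord mulr_natl.
Qed.

End Families.

End FirstReturn.

(** * Framed blocks of cyclically permuted partitions *)

Section BlockFrames.

Variables (T : finType) (t0 : T) (d : nat).
Implicit Types (x : {perm T}) (P : setpart T) (g : {ffun 'I_d -> T}) (y : {perm 'I_d}).

Definition frames P : pred {ffun 'I_d -> T} :=
  fun g => injectiveb g && ([set g j | j : 'I_d] \in blocks P).

Definition cyclic_frame x P g :=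
  [&& frames P g, P \in 'Fix_(setpart_action T)([set x])%g
    & [forall u, forall v, orbit_join x P u v]].

(** Let [e] be the least positive exponent for which [x ^+ e] returns the framed block to itself.
    The translates by smaller powers are distinct, transitivity shows that they exhaust the blocks,
    and [y] is the action of [x ^+ e] on the frame. Counting coordinates gives [d * e]. *)
Lemma cyclic_frameP x P g : cyclic_frame x P g ->
  exists e y, (d * e)%N = #|T| /\ framed x P g e y.
Proof.
case/and3P=> /andP[/injectiveP gI gP] /fix_same Px' xtrans.
have Px : forall u v, same P (x u) (x v) = same P u v by apply: Px'; rewrite inE.
have [_ /imsetP[j0 _ _]] := setpart_block_inh gP.
have gB v : reflect (exists j, v = g j) (same P (g j0) v).
  rewrite sameE -(setpart_blockE (x := g j0) gP) ?imset_f //.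
  by apply: (iffP imsetP) => [[j _ ->]|[j ->]]; exists j.
have gg j : same P (g j0) (g j) by apply/gB; exists j.
pose back k := (0 < k)%N && same P (g j0) ((x ^+ k)%g (g j0)).
have ex_back : exists k, back k.
  by exists #[x]%g; rewrite /back order_gt0 expg_order perm1 same_refl.
have [e /andP[e0 xe] e_min] := ex_minnP ex_back.
have cycle n m t : (x ^+ n)%g ((x ^+ m)%g t) = (x ^+ (m + n))%g t by rewrite expgD permM.
have shift n j : same P ((x ^+ n)%g (g j0)) ((x ^+ n)%g (g j)) by rewrite same_expg.
have mod_e n : same P ((x ^+ (n %% e))%g (g j0)) ((x ^+ n)%g (g j0)).
  have xq q : same P (g j0) ((x ^+ (q * e))%g (g j0)).
    elim: q => [|q IH]; first by rewrite mul0n expg0 perm1 same_refl.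
    by apply: same_trans xe _; rewrite mulSnr -cycle same_expg.
  by rewrite {2}(divn_eq n e) -cycle same_expg.
have lt_e i i' : (i < i')%N -> (i' < e)%N ->
    ~~ same P ((x ^+ i)%g (g j0)) ((x ^+ i')%g (g j0)).
  move=> ii' i'e; rewrite -(subnK (ltnW ii')) -cycle same_expg //.
  apply/negP => Pi; have := e_min (i' - i)%N; rewrite /back subn_gt0 ii' Pi => /(_ isT).
  by rewrite leqNgt (leq_ltn_trans (leq_subr _ _) i'e).
have sameP i i' j j' : (i < e)%N -> (i' < e)%N ->
    same P ((x ^+ i)%g (g j)) ((x ^+ i')%g (g j')) = (i == i').
  move=> ie i'e; rewrite -(same_left (shift i j)) -(same_right (shift i' j')).
  have [->|] := eqVneq i i'; first exact: same_refl.
  rewrite neq_ltn => /orP[] ii'; apply/negbTE; first exact: lt_e.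
  by rewrite same_sym lt_e.
have ret j : exists j', (x ^+ e)%g (g j) == g j'.
  have /gB[j' ->] : same P (g j0) ((x ^+ e)%g (g j)) by apply: same_trans xe _.
  by exists j'.
have yI : injective (fun j => xchoose (ret j)).
  move=> j j' E; have /eqP := xchooseP (ret j); rewrite E => Ej.
  by have /eqP := xchooseP (ret j'); rewrite -Ej => /perm_inj/gI.
have fr : framed x P g e (perm yI).
  split=> // [t|j]; last by rewrite permE; apply/eqP/(xchooseP (ret j)).
  move/forallP/(_ (g j0))/forallP/(_ t)/orbit_joinP: xtrans => -[n Pn].
  have Pt := same_trans (mod_e n) Pn; have ne : (n %% e < e)%N by rewrite ltn_mod.
  pose t' := ((x ^+ (n %% e))^-1)%g t.
  have tE : t = (x ^+ (n %% e))%g t' by rewrite permKV.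
  have /gB[j t'E] : same P (g j0) t' by rewrite -(same_expg (n %% e) _ _ Px) -tE.
  by exists (j, Ordinal ne); rewrite /= -t'E.
exists e, (perm yI); split=> //.
have [h hE hK] := framed_coordinates fr.
rewrite -[d]card_ord -[e]card_ord -card_prod; apply/esym.
apply: (bij_eq_card (f := h)); exists (fun p : 'I_d * 'I_e => (x ^+ p.2)%g (g p.1)) => [t|[j i]].
  exact: hE.
exact: hK.
Qed.

Lemma framed_cyclic_frame (x : {perm T}) P g e y (j0 : 'I_d) :
  framed x P g e y -> cyclic_frame x P g.
Proof.
move=> fr; have [gI sameP surj ret] := fr; have e0 := framed_gt0 t0 fr.
have Px u v : same P (x u) (x v) = same P u v := framed_cycle t0 fr u v.
apply/and3P; split.
- apply/andP; split; first exact/injectiveP.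
  rewrite (_ : [set g j | j : 'I_d] = pblock P (g j0)) ?pblock_setpart //.
  apply/setP => t; rewrite pblockE inE.
  have [[j i] /= ->] := surj t.
  rewrite -[g j0](perm1 (g j0)) -[1%g](expg0 x) sameP //.
  apply/imsetP/eqP => [[j' _ E]|<-]; last by exists j; rewrite ?expg0 ?perm1.
  have [] := framed_inj fr (i := i) (i' := 0%N) (j := j) (j' := j') => //.
  by rewrite E expg0 perm1.
- by apply/fix_same => s; rewrite inE => /eqP->.
- apply/forallP => u; apply/forallP => v; apply/orbit_joinP.
  have [[j i] /= ->] := surj u; have [[j' i'] /= ->] := surj v.
  (* The first [e - i] steps complete the turn from translate [i] back to the frame; [i'] more reach
     translate [i']. *)
  exists ((e - i) + i')%N; rewrite -permM -expgD addnA subnKC; last exact: ltnW.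
  by rewrite (framed_same t0 fr) modnDl.
Qed.

End BlockFrames.

(** * Mapping tori: parametrizing permutations with a framed block *)

Section Suspension.

Variables (T : finType) (t0 : T) (d e : nat).
Hypothesis card_de : (d * e.+1)%N = #|T|.
Local Notation M := ('I_d * 'I_e.+1)%type.
Implicit Types (y : {perm 'I_d}) (s : {perm T}).

Fact suspension_coordinates : {h : M -> T & {k : T -> M | cancel h k & cancel k h}}.
Proof.
have E : #|{: M}| = #|T| by rewrite card_prod !card_ord.
exists (fun p => enum_val (cast_ord E (enum_rank p))).
exists (fun t => enum_val (cast_ord (esym E) (enum_rank t))) => z.
  by rewrite enum_valK cast_ordK enum_rankK.
by rewrite enum_valK cast_ordKV enum_rankK.
Qed.

Let h : M -> T := projT1 suspension_coordinates.
Let k : T -> M := s2val (projT2 suspension_coordinates).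
Let hK : cancel h k. Proof. exact: (s2valP (projT2 suspension_coordinates)). Qed.
Let kK : cancel k h. Proof. exact: (s2valP' (projT2 suspension_coordinates)). Qed.

(* Mapping torus of [y]: the shift of the second coordinate, twisted by [y] on
   the last level so that the first return to level [ord0] is [y]. *)
Definition suspend y (p : M) : M :=
  (if p.2 == ord_max then y p.1 else p.1, ordS p.2).

Fact suspend_inj y : injective (suspend y).
Proof.
move=> [j i] [j' i'] E; have ii' : i = i' by apply: ordS_inj; apply: (congr1 snd E).
have := congr1 fst E; rewrite ii' /=.
by case: eqP => [_ /perm_inj ->|_ ->].
Qed.

Fact suspension_inj s y : injective (fun t => s (h (suspend y (k (s^-1 t)%g)))).
Proof.
by move=> u v /perm_inj/(can_inj hK)/suspend_inj/(can_inj kK)/perm_inj.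
Qed.

(** The mapping torus of [y] is carried to [T] by the fixed bijection [h] followed by the
    relabelling [s]; its levels become the blocks and level [ord0] the frame. The composite of [h]
    and [s] is the coordinate system of the resulting triple, so [s] is recovered from the triple,
    and [y] as its first return. *)
Definition suspension (sy : {perm T} * {perm 'I_d}) :
    {perm T} * setpart T * {ffun 'I_d -> T} :=
  (perm (@suspension_inj sy.1 sy.2),
   part_of (fun u v => (k ((sy.1)^-1 u)%g).2 == (k ((sy.1)^-1 v)%g).2),
   [ffun j => sy.1 (h (j, ord0))]).

Lemma suspension_cycle s y (i : 'I_e.+1) j :
  ((suspension (s, y)).1.1 ^+ i)%g ((suspension (s, y)).2 j) = s (h (j, i)).
Proof.
rewrite /= ffunE; case: i => i; elim: i => [|i IH] ie.
  by rewrite expg0 perm1; congr (s (h (_, _))); apply: val_inj.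
have ie' := ltnW ie; rewrite expgSr permM (IH ie') permE permK hK /suspend /=.
rewrite ifN; last by rewrite -val_eqE /= neq_ltn -ltnS ie.
by congr (s (h (_, _))); apply: val_inj; rewrite /= modn_small.
Qed.

Lemma suspension_same s y p q :
  same (suspension (s, y)).1.2 (s (h p)) (s (h q)) = (p.2 == q.2).
Proof.
rewrite same_part_of ?permK ?hK // => u v w.
by split=> // /eqP->.
Qed.

Lemma framed_suspension s y :
  framed (suspension (s, y)).1.1 (suspension (s, y)).1.2 (suspension (s, y)).2 e.+1 y.
Proof.
have sh t : s (h (k (s^-1 t)%g)) = t by rewrite kK permKV.
split=> [j j'|i i' j j' ie i'e|t|j].
- by rewrite !ffunE => /perm_inj/(can_inj hK) [].
- rewrite (suspension_cycle s y (Ordinal ie)) (suspension_cycle s y (Ordinal i'e)).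
  by rewrite suspension_same.
- by exists (k (s^-1 t)%g); rewrite suspension_cycle -surjective_pairing sh.
- rewrite expgSr permM (suspension_cycle s y ord_max) permE permK hK /suspend /= eqxx.
  by rewrite ffunE; congr (s (h (_, _))); apply: val_inj; rewrite /= modnn.
Qed.

Lemma suspension_injective : injective suspension.
Proof.
move=> [s y] [s' y'] E.
have sh p : s (h p) = s' (h p).
  by rewrite [p]surjective_pairing -(suspension_cycle s y) E suspension_cycle.
have ss' : s = s' by apply/permP => t; rewrite -(kK t) sh.
congr (_, _) => //; apply/permP => j.
have [gI _ _ ret] := framed_suspension s y.
have [_ _ _ ret'] := framed_suspension s' y'.
by apply: gI; rewrite -ret E ret'.
Qed.

Lemma suspension_surj x P (g : {ffun 'I_d -> T}) y : framed x P g e.+1 y ->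
  exists s, suspension (s, y) = (x, P, g).
Proof.
move=> fr; have [gI sameP surj ret] := fr.
have sI : injective (fun t => (x ^+ (k t).2)%g (g (k t).1)).
  move=> u v /(framed_inj fr)[] // /val_inj k2 k1; apply: (can_inj kK).
  by rewrite [k u]surjective_pairing k1 k2 -surjective_pairing.
(* The relabelling is forced: it must send [h (j, i)] to the point of coordinates [(j, i)]. *)
pose s := perm sI; have sE p : s (h p) = (x ^+ p.2)%g (g p.1) by rewrite permE hK.
exists s; congr (_, _, _).
- apply: (perm_framed fr) => i j; have := sE (j, i); rewrite /= => <-.
  rewrite permE permK hK sE /suspend /= -val_eqE /=.
  have [ie|ie] := eqVneq (val i) e.
    by rewrite {1}ie modnn expg0 perm1 -ret sE /= ie expgSr permM.
  have lt_ie : (i.+1 < e.+1)%N by rewrite ltnS ltn_neqAle ie -ltnS ltn_ord.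
  by rewrite modn_small // sE expgSr permM.
- apply: same_inj => u v; rewrite -(permKV s u) -(permKV s v).
  rewrite -(kK (s^-1 u)%g) -(kK (s^-1 v)%g) (suspension_same s y) !sE sameP //.
- by apply/ffunP => j; rewrite ffunE sE expg0 perm1.
Qed.

End Suspension.

(** * The recurrence on the number of commuting permutations *)

(** This is the sum for commuting tuples of length [r + 1] with the first entry split off, the form
    in which the recurrence produces it; [sum_cons_family] makes the identification. *)
Definition moebius_sum_centralizing r (T : finType) (t0 : T) : int :=
  \sum_(x : {perm T}) \sum_(X : {ffun 'I_r -> {perm T}} | centralizing_family x X)
     top_moebius t0 (family_set x X).

Definition moebius_sum_commuting r (T : finType) (t0 : T) : int :=
  \sum_(X : {ffun 'I_r -> {perm T}} | commuting_family X)
     top_moebius t0 [set X i | i : 'I_r].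

Section Recurrence.

Variables (T : finType) (t0 : T).
Implicit Types (x : {perm T}) (P : setpart T).
Local Notation n := #|T|.

Lemma card_frames d P :
  #|@frames T d P| = (\sum_(B in blocks P) (#|B| == d) * d`!)%N.
Proof.
rewrite -sum1_card.
rewrite (partition_big (fun g : {ffun 'I_d -> T} => [set g j | j : 'I_d]) (mem (blocks P))) /=; last first.
  by move=> g /andP[].
apply: eq_bigr => B PB.
have [Bd|Bd] := eqVneq #|B| d; last first.
  rewrite mul0n big1 // => g /andP[/andP[/injectiveP gI _] /eqP gB].
  by case/eqP: Bd; rewrite -gB card_imset // card_ord.
have <- : #|[set g : {ffun 'I_d -> T} in ffun_on (mem B) | injectiveb g]| = d`!.
  rewrite card_inj_ffuns_on card_ord -ffactnn; congr (_ ^_ _).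
  by rewrite -[RHS]Bd; apply: eq_card.
rewrite mul1n sum1_card; apply: eq_card => g; rewrite inE.
apply/andP/andP => [[/andP[gI _] /eqP gB]|[gB gI]].
  by split=> //; apply/ffun_onP => j; rewrite -gB imset_f.
suff gE : [set g j | j : 'I_d] = B by rewrite gE eqxx unfold_in gE gI.
apply/eqP; rewrite eqEcard; apply/andP; split.
  by apply/subsetP => _ /imsetP[j _ ->]; apply/ffun_onP.
by rewrite card_imset ?card_ord ?Bd //; apply/injectiveP.
Qed.

(* This weighting makes it possible to sum over pairs (partition, framed block)
   instead of partitions without knowing that the blocks have equal sizes. *)
Lemma sum_frames P :
  \sum_(d < n) (n%:R * d`!%:R)^-1 * #|@frames T d.+1 P|%:R = 1 :> rat.
Proof.
have n0 : (0 < n)%N by apply/card_gt0P; exists t0.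
transitivity (\sum_(d < n) \sum_(B in blocks P) (#|B| == d.+1)%:R * (d.+1%:R / n%:R) : rat).
  apply: eq_bigr => d _; rewrite card_frames natr_sum mulr_sumr; apply: eq_bigr => B _.
  rewrite natrM mulrCA factS natrM; congr (_ * _); rewrite invfM mulrC.
  by rewrite -mulrA; congr (_ * _); rewrite mulrCA divff ?mulr1 // pnatr_eq0 -lt0n fact_gt0.
rewrite exchange_big /=.
transitivity (\sum_(B in blocks P) #|B|%:R / n%:R : rat).
  apply: eq_bigr => B PB; have [t tB] := setpart_block_inh PB.
  have B0 : (0 < #|B|)%N by apply/card_gt0P; exists t.
  have Bn : (#|B|.-1 < n)%N by rewrite prednK // max_card.
  rewrite (bigD1 (Ordinal Bn)) //= prednK // eqxx mul1r big1 ?addr0 // => d dB.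
  rewrite (_ : #|B| == d.+1 = false) ?mul0r //; apply: contraNF dB => /eqP Bd.
  by apply/eqP/val_inj; rewrite /= Bd.
by rewrite -mulr_suml -natr_sum -(card_partition (valP P)) cardsT divff // pnatr_eq0 -lt0n.
Qed.

(** By [weisner] the inner sum vanishes unless [x = 1], where it is the Moebius number for [X]:
    adjoining the identity does not change the fixed partitions. *)
Lemma moebius_sum_commuting_recr r :
  moebius_sum_commuting r t0 =
  \sum_(x : {perm T}) \sum_(X : {ffun 'I_r -> {perm T}} | centralizing_family x X)
    \sum_(P in 'Fix_(setpart_action T)(family_set x X)%g |
          [forall u, forall v, orbit_join x P u v])
      moebius (discrete_part T) 'Fix_(setpart_action T)(family_set x X)%g P.
Proof.
rewrite (bigD1 1%g) //= [X in _ + X]big1 ?addr0 => [|x x1]; last first.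
  apply: big1 => X cX; rewrite (weisner t0) ?(negPf x1) //; first by rewrite !inE eqxx.
  by have /centralizing_familyP[_ xX] := cX; apply/family_setP; split.
apply: eq_big => X.
  rewrite /centralizing_family andbC; case: forallP => // -[] i.
  by rewrite mul1g mulg1.
move=> _; have cA s : s \in family_set 1%g X -> commute 1%g s.
  by move=> _; rewrite /commute mul1g mulg1.
rewrite (weisner t0 (setU11 _ _) cA) eqxx.
rewrite /top_moebius; congr moebius; apply/setP => P.
apply/fix_same/fix_same => PX => [|s sX]; last by apply: PX; rewrite inE sX orbT.
apply/family_setP; split=> [u v|i]; first by rewrite !perm1.
by apply: PX; rewrite imset_f.
Qed.

(** The triples are reparametrized as suspensions of pairs [(s, y)]. By [framed_sum] the summand
    depends on [y] alone, so [s] contributes the factorial. *)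
Lemma cyclic_frame_sum r d e : (d.+1 * e.+1)%N = n ->
  \sum_(u : {perm T} * setpart T * {ffun 'I_d.+1 -> T} | cyclic_frame u.1.1 u.1.2 u.2)
    \sum_(X : {ffun 'I_r -> {perm T}} | centralizing_family u.1.1 X &&
          (u.1.2 \in 'Fix_(setpart_action T)(family_set u.1.1 X)%g))
      moebius (discrete_part T) 'Fix_(setpart_action T)(family_set u.1.1 X)%g u.1.2
  = n`!%:R * (e.+1 ^ r)%:R * moebius_sum_centralizing r (ord0 : 'I_d.+1).
Proof.
move=> card_de.
transitivity (\sum_(u in [set suspension card_de sy | sy in predT])
    \sum_(X : {ffun 'I_r -> {perm T}} | centralizing_family u.1.1 X &&
          (u.1.2 \in 'Fix_(setpart_action T)(family_set u.1.1 X)%g))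
      moebius (discrete_part T) 'Fix_(setpart_action T)(family_set u.1.1 X)%g u.1.2).
  apply: eq_bigl => -[[x P] g] /=; apply/idP/imsetP => [uP|[[s y] _ E]]; last first.
    have := framed_suspension card_de s y; rewrite -E => fr.
    exact: (framed_cyclic_frame t0 ord0 fr).
  have [e' [y [de' fr]]] := cyclic_frameP uP.
  have ee' : e' = e.+1 by apply/eqP; rewrite -(eqn_pmul2l (ltn0Sn d)) de' card_de.
  rewrite ee' in fr; have [s sE] := suspension_surj card_de fr.
  by exists (s, y).
rewrite big_imset /=; last by move=> u v _ _; apply: suspension_injective.
transitivity (\sum_(sy : {perm T} * {perm 'I_d.+1}) (e.+1 ^ r)%:R *
    \sum_(w : {ffun 'I_r -> {perm 'I_d.+1}} | centralizing_family sy.2 w)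
       top_moebius ord0 (family_set sy.2 w)).
  apply: eq_bigr => -[s y] _.
  exact: (framed_sum t0 ord0 (framed_suspension card_de s y)).
rewrite -mulr_sumr -mulrA mulrCA; congr (_ * _).
rewrite -(pair_big predT predT (fun (s : {perm T}) (y : {perm 'I_d.+1}) =>
    \sum_(w : {ffun 'I_r -> {perm 'I_d.+1}} | centralizing_family y w)
       top_moebius ord0 (family_set y w))) /=.
have card_permT : #|{: {perm T}}| = n`!.
  have := card_perm [set: T]; rewrite cardsT => <-; apply: eq_card => s.
  by rewrite inE; apply/esym/subsetP => t; rewrite inE.
by rewrite sumr_const card_permT mulr_natl.
Qed.

Lemma moebius_sum_recurrence r :
  (moebius_sum_commuting r t0)%:~R =
  \sum_(d < n | (d.+1 %| n)%N) n`!%:R / (n%:R * d`!%:R) * ((n %/ d.+1) ^ r)%:R *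
     (moebius_sum_centralizing r (ord0 : 'I_d.+1))%:~R :> rat.
Proof.
pose w x P := \sum_(X : {ffun 'I_r -> {perm T}} | centralizing_family x X &&
    (P \in 'Fix_(setpart_action T)(family_set x X)%g))
  moebius (discrete_part T) 'Fix_(setpart_action T)(family_set x X)%g P.
pose trans x P := [forall u, forall v, orbit_join x P u v].
have sum_w : moebius_sum_commuting r t0 =
    \sum_(xP : {perm T} * setpart T | trans xP.1 xP.2) w xP.1 xP.2.
  rewrite moebius_sum_commuting_recr -(pair_big_dep predT trans w) /=.
  apply: eq_bigr => x _; rewrite (exchange_big_dep (trans x)) /=; last first.
    by move=> X P _ /andP[].
  apply: eq_bigr => P xP; apply: eq_bigl => X; by rewrite -/(trans x P) xP andbT.
(* [cyclic_frame] also requires [P] to be [x]-invariant, which [trans] does not; the other [P] are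
   fixed by no family and contribute zero. *)
have w_fix x P : P \notin 'Fix_(setpart_action T)([set x])%g -> w x P = 0.
  move=> xP; apply: big1 => X /andP[_ PX]; case/negP: xP; apply: subsetP PX.
  by apply: afixS; rewrite sub1set setU11.
pose S d := \sum_(u : {perm T} * setpart T * {ffun 'I_d.+1 -> T} | cyclic_frame u.1.1 u.1.2 u.2)
   w u.1.1 u.1.2.
transitivity (\sum_(d < n) (n%:R * d`!%:R)^-1 * (S d)%:~R : rat).
  rewrite sum_w rmorph_sum /=.
  transitivity (\sum_(xP : {perm T} * setpart T | trans xP.1 xP.2) \sum_(d < n)
      (n%:R * d`!%:R)^-1 * ((w xP.1 xP.2) * #|@frames T d.+1 xP.2|%:R)%:~R : rat).
    (* Each partition is weighted by the total 1 of [sum_frames], which replaces it by its framed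
       blocks, sorted by size [d.+1]. *)
    apply: eq_bigr => -[x P] _ /=; rewrite -[LHS]mulr1 -[X in _ * X = _](sum_frames P) mulr_sumr.
    by apply: eq_bigr => d _; rewrite intrM natz -pmulrn mulrCA.
  rewrite exchange_big /=; apply: eq_bigr => d _; rewrite -mulr_sumr; congr (_ * _).
  rewrite -rmorph_sum /=; congr (_%:~R).
  transitivity (\sum_(xP : {perm T} * setpart T | trans xP.1 xP.2)
      \sum_(g : {ffun 'I_d.+1 -> T} | frames xP.2 g) w xP.1 xP.2).
    by apply: eq_bigr => xP _; rewrite sumr_const mulr_natr.
  rewrite pair_big_dep /= /S big_mkcond [RHS]big_mkcond /=.
  apply: eq_bigr => -[[x P] g] _ /=; rewrite /cyclic_frame -/(trans x P).
  case: (boolP (P \in _)) => [_|/w_fix ->]; last by rewrite !if_same.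
  by rewrite andbC.
rewrite (bigID (fun d : 'I_n => d.+1 %| n)%N) /= [X in _ + X]big1 ?addr0.
  apply: eq_bigr => d dn; have n0 := leq_ltn_trans (leq0n d) (ltn_ord d).
  have e0 : (0 < n %/ d.+1)%N by rewrite divn_gt0 // ltn_ord.
  have de : (d.+1 * (n %/ d.+1).-1.+1)%N = n by rewrite prednK // mulnC divnK.
  by rewrite /S /w (cyclic_frame_sum r de) prednK // !intrM !natz -!pmulrn; ring.
(* A cyclic frame of size [d.+1] forces [d.+1] to divide the number of points. *)
move=> d dn; rewrite /S big1 ?mulr0 // => -[[x P] g] /cyclic_frameP[e [y [de _]]].
by case/negP: dn; apply/dvdnP; exists e; rewrite -[LHS]de mulnC.
Qed.

End Recurrence.

(** * Dirichlet convolution *)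

Section DirichletConvolution.

Implicit Types (f g h : nat -> rat) (m n : nat).

Lemma big_divisors n (F : nat -> rat) : (0 < n)%N ->
  \sum_(d <- divisors n) F d = \sum_(d < n | (d.+1 %| n)%N) F d.+1.
Proof.
move=> n0; have E : perm_eq (divisors n) [seq d <- index_iota 1 n.+1 | (d %| n)%N].
  apply: uniq_perm; rewrite ?divisors_uniq ?filter_uniq ?iota_uniq // => d.
  rewrite mem_filter mem_index_iota -dvdn_divisors // andbC.
  case: (boolP (d %| n)%N) => dn; rewrite ?andbF ?andbT //.
  by rewrite (dvdn_gt0 n0 dn) ltnS dvdn_leq.
by rewrite (perm_big _ E) big_filter big_add1 big_mkord.
Qed.

(** The bound [N] is independent of [n], so nested convolutions range over the same box and can be
    rearranged by exchanging sums. Index 0 is harmless, since [n] is positive. *)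
Lemma dirichlet_convE N f g n : (0 < n < N)%N ->
  dirichlet_conv f g n = \sum_(i < N) \sum_(j < N) (i * j == n)%N%:R * (f i * g j).
Proof.
case/andP=> n0 nN; rewrite /dirichlet_conv.
have E : perm_eq (divisors n) [seq d <- index_iota 0 N | (d %| n)%N].
  apply: uniq_perm; rewrite ?divisors_uniq ?filter_uniq ?iota_uniq // => d.
  rewrite mem_filter mem_index_iota -dvdn_divisors // andbC.
  case: (boolP (d %| n)%N) => dn; rewrite ?andbF ?andbT //.
  by rewrite (leq_ltn_trans (dvdn_leq n0 dn)).
rewrite (perm_big _ E) big_filter big_mkord big_mkcond /=; apply: eq_bigr => i _.
case: ifPn => [|ni].
  case/dvdnP=> q nE; have i0 : (0 < i)%N by move: n0; rewrite nE muln_gt0 => /andP[].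
  have qN : (q < N)%N by apply: leq_ltn_trans nN; rewrite nE leq_pmulr.
  rewrite {1}nE mulnK // (bigD1 (Ordinal qN)) //= mulnC -nE eqxx mul1r.
  rewrite big1 ?addr0 // => j jq; rewrite (_ : _ == _ = false) ?mul0r //.
  apply: contraNF jq => /eqP ijn; apply/eqP/val_inj/eqP => /=.
  by rewrite -(eqn_pmul2l i0) ijn nE mulnC.
rewrite big1 // => j _; rewrite (_ : _ == _ = false) ?mul0r //.
by apply: contraNF ni => /eqP <-; apply: dvdn_mulr.
Qed.

Lemma eq_dirichlet_conv f f' g g' n : (0 < n)%N ->
  (forall i, (0 < i)%N -> f i = f' i) -> (forall i, (0 < i)%N -> g i = g' i) ->
  dirichlet_conv f g n = dirichlet_conv f' g' n.
Proof.
move=> n0 ff' gg'; apply: eq_big_seq => d; rewrite -dvdn_divisors // => dn.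
have d0 := dvdn_gt0 n0 dn; rewrite (ff' d d0) (gg' (n %/ d)%N) //.
by rewrite divn_gt0 // dvdn_leq.
Qed.

(** Both sides expand to the sum over triples with product [n]; the intermediate product is
    determined by the triple and is at most [n]. *)
Lemma dirichlet_convA f g h n : (0 < n)%N ->
  dirichlet_conv (dirichlet_conv f g) h n = dirichlet_conv f (dirichlet_conv g h) n.
Proof.
move=> n0; have nN : (0 < n < n.+1)%N by rewrite n0 /=.
have pos a b : (a * b)%N = n -> (0 < a)%N && (0 < b)%N by move=> ab; rewrite -muln_gt0 ab.
pose T i j k : rat := (i * j * k == n)%N%:R * (f i * g j * h k).
transitivity (\sum_(i < n.+1) \sum_(j < n.+1) \sum_(k < n.+1) T i j k).
  rewrite (dirichlet_convE _ _ nN).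
  transitivity (\sum_(l < n.+1) \sum_(k < n.+1) \sum_(i < n.+1) \sum_(j < n.+1)
      (l * k == n)%N%:R * (i * j == l)%N%:R * (f i * g j * h k)).
    apply: eq_bigr => l _; apply: eq_bigr => k _.
    have [lk|] := eqVneq (l * k)%N n; last first.
      by rewrite !mul0r big1 // => i _; rewrite big1 // => j _; rewrite !mul0r.
    have l0 : (0 < l)%N by have /andP[] := pos _ _ lk.
    rewrite mul1r (@dirichlet_convE n.+1) ?l0 ?ltn_ord // mulr_suml.
    by apply: eq_bigr => i _; rewrite mulr_suml; apply: eq_bigr => j _; rewrite mul1r -!mulrA.
  rewrite exchange_big /=; under eq_bigr do rewrite exchange_big /=.
  rewrite exchange_big /=; apply: eq_bigr => i _.
  under eq_bigr do rewrite exchange_big /=.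
  rewrite exchange_big /=; apply: eq_bigr => j _; apply: eq_bigr => k _.
  rewrite /T; have [ijk|ijk] := eqVneq (i * j * k)%N n.
    have ij : (i * j < n.+1)%N.
      by rewrite ltnS -[X in (_ <= X)%N]ijk leq_pmulr //; case/andP: (pos _ _ ijk).
    rewrite (bigD1 (Ordinal ij)) //= ijk !eqxx !mul1r big1 ?addr0 // => l lij.
    rewrite (_ : (i * j)%N == l = false) ?mulr0 ?mul0r //.
    by apply: contraNF lij => /eqP lE; apply/eqP/val_inj; rewrite /= lE.
  rewrite mul0r big1 // => l _.
  have [<-|_] := eqVneq (i * j)%N l; last by rewrite mulr0 mul0r.
  by rewrite (negPf ijk) !mul0r.
rewrite (dirichlet_convE _ _ nN).
transitivity (\sum_(i < n.+1) \sum_(l < n.+1) \sum_(j < n.+1) \sum_(k < n.+1)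
    (i * l == n)%N%:R * (j * k == l)%N%:R * (f i * g j * h k)); last first.
  apply: eq_bigr => i _; apply: eq_bigr => l _.
  have [il|] := eqVneq (i * l)%N n; last first.
    by rewrite !mul0r big1 // => j _; rewrite big1 // => k _; rewrite !mul0r.
  have l0 : (0 < l)%N by have /andP[] := pos _ _ il.
  rewrite mul1r (@dirichlet_convE n.+1) ?l0 ?ltn_ord // mulr_sumr.
  apply: eq_bigr => j _; rewrite mulr_sumr; apply: eq_bigr => k _.
  by rewrite -!mulrA mul1r [LHS]mulrCA.
apply: eq_bigr => i _; rewrite [RHS]exchange_big /=; apply: eq_bigr => j _.
rewrite [RHS]exchange_big /=; apply: eq_bigr => k _.
rewrite /T; have [ijk|ijk] := eqVneq (i * j * k)%N n.
  have jk : (j * k < n.+1)%N.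
    rewrite ltnS -[X in (_ <= X)%N]ijk -mulnA leq_pmull //.
    by move: ijk; rewrite -mulnA => /pos/andP[].
  rewrite (bigD1 (Ordinal jk)) //= mulnA ijk !eqxx !mul1r big1 ?addr0 // => l ljk.
  rewrite (_ : (j * k)%N == l = false) ?mulr0 ?mul0r //.
  by apply: contraNF ljk => /eqP lE; apply/eqP/val_inj; rewrite /= lE.
rewrite mul0r big1 // => l _.
have [<-|_] := eqVneq (j * k)%N l; last by rewrite mulr0 mul0r.
by rewrite mulnA (negPf ijk) !mul0r.
Qed.

(** In the convolution at [n], the divisor [n] contributes [f n * g 1], and the smaller divisors
    agree by induction. *)
Lemma dirichlet_conv_cancel f f' g : g 1%N != 0 ->
  (forall n, (0 < n)%N -> dirichlet_conv f g n = dirichlet_conv f' g n) ->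
  forall n, (0 < n)%N -> f n = f' n.
Proof.
move=> g1 fg n; elim/ltn_ind: n => n IH n0.
have := fg n n0; rewrite /dirichlet_conv !big_divisors //.
have n1 : (n.-1 < n)%N by rewrite prednK.
rewrite !(bigD1 (P := fun d : 'I_n => (d.+1 %| n)%N) (Ordinal n1)) /= ?prednK //.
rewrite (eq_bigr (fun d : 'I_n => f' d.+1 * g (n %/ d.+1)%N)) => [/addIr|d].
  by rewrite divnn n0 => /(mulIf g1).
case/andP=> _ dn; rewrite IH //; rewrite ltn_neqAle ltn_ord andbT.
by apply: contraNneq dn => dn; apply/eqP/val_inj; rewrite /= -[X in X.-1]dn.
Qed.

(** A divisor of [m * n] splits uniquely, its factor in [m] being its gcd with [m]. *)
Lemma divisorsM m n : (0 < m)%N -> (0 < n)%N -> coprime m n ->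
  perm_eq (divisors (m * n)) [seq (x * y)%N | x <- divisors m, y <- divisors n].
Proof.
move=> m0 n0 mn; have mn0 : (0 < m * n)%N by rewrite muln_gt0 m0.
apply: uniq_perm; rewrite ?divisors_uniq ?allpairs_uniq ?divisors_uniq //.
  move=> _ _ /allpairsP[[x y] /= [xm yn ->]] /allpairsP[[x' y'] /= [xm' yn' ->]] /= E.
  rewrite -!dvdn_divisors // in xm yn xm' yn'.
  have gcdl z w : (z %| m)%N -> (w %| n)%N -> gcdn m (z * w) = z.
    move=> zm wn; rewrite Gauss_gcdl; first exact/gcdn_idPr.
    exact: coprime_dvdr wn mn.
  have xx' : x = x' by rewrite -(gcdl x y) // E gcdl.
  congr (_, _) => //; apply/eqP; rewrite -(eqn_pmul2l (dvdn_gt0 m0 xm)) E xx' //.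
move=> d; rewrite -dvdn_divisors //; apply/idP/allpairsP => [dmn|[[x y] /= [xm yn ->]]].
  have d0 := dvdn_gt0 mn0 dmn; have g0 : (0 < gcdn d m)%N by rewrite gcdn_gt0 d0.
  exists (gcdn d m, d %/ gcdn d m)%N; rewrite -!dvdn_divisors //= dvdn_gcdr.
  rewrite mulnC divnK ?dvdn_gcdl //; split=> //.
  have cop : coprime (d %/ gcdn d m) (m %/ gcdn d m).
    rewrite /coprime -(eqn_pmul2r g0) muln_gcdl !divnK ?dvdn_gcdl ?dvdn_gcdr //.
    by rewrite mul1n.
  rewrite -(Gauss_dvdr _ cop) -(dvdn_pmul2r g0) divnK ?dvdn_gcdl //.
  by rewrite mulnAC divnK ?dvdn_gcdr.
by rewrite -!dvdn_divisors // in xm yn *; apply: dvdn_mul.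
Qed.

Lemma dirichlet_conv_multiplicative f g :
  multiplicative_fun f -> multiplicative_fun g -> multiplicative_fun (dirichlet_conv f g).
Proof.
move=> [f1 fM] [g1 gM]; split=> [|m n m0 n0 mn].
  by rewrite /dirichlet_conv big_seq1 f1 divn1 g1 mulr1.
rewrite /dirichlet_conv (perm_big _ (divisorsM m0 n0 mn)) big_allpairs_dep /=.
rewrite mulr_suml; apply: eq_big_seq => x; rewrite -dvdn_divisors // => xm.
rewrite mulr_sumr; apply: eq_big_seq => y; rewrite -dvdn_divisors // => yn.
have [x0 y0] := (dvdn_gt0 m0 xm, dvdn_gt0 n0 yn).
have cop : coprime x y := coprime_dvdl xm (coprime_dvdr yn mn).
rewrite fM // (_ : (m * n) %/ (x * y) = (m %/ x) * (n %/ y))%N; last first.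
  by rewrite -{1}(divnK xm) -{1}(divnK yn) mulnACA mulnK // muln_gt0 x0.
have mx : (0 < m %/ x)%N by rewrite divn_gt0 // dvdn_leq.
have ny : (0 < n %/ y)%N by rewrite divn_gt0 // dvdn_leq.
rewrite gM //; first by rewrite mulrACA.
apply: coprime_dvdl (coprime_dvdr _ mn); first by rewrite -{2}(divnK xm) dvdn_mulr.
by rewrite -{2}(divnK yn) dvdn_mulr.
Qed.

Lemma dirichlet_conv_pfactor f g p k : prime p ->
  dirichlet_conv f g (p ^ k)%N = \sum_(j < k.+1) f (p ^ j)%N * g (p ^ (k - j))%N.
Proof.
move=> pp; have p1 := prime_gt1 pp; have p0 := prime_gt0 pp.
have E : perm_eq (divisors (p ^ k)) [seq (p ^ j)%N | j <- iota 0 k.+1].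
  apply: uniq_perm; rewrite ?divisors_uniq ?map_inj_uniq ?iota_uniq //.
    by move=> i j /eqP; rewrite eqn_exp2l // => /eqP.
  move=> d; rewrite -dvdn_divisors ?expn_gt0 ?p0 //.
  apply/(dvdn_pfactor _ _ pp)/mapP => -[j jk ->]; exists j => //.
    by rewrite mem_iota add0n ltnS.
  by move: jk; rewrite mem_iota add0n ltnS.
rewrite /dirichlet_conv (perm_big _ E) big_map -/(index_iota 0 k.+1) big_mkord.
by apply: eq_bigr => j _; rewrite -expnB // -ltnS ltn_ord.
Qed.

(** Split off the full power of the least prime factor and use induction on the cofactor. *)
Lemma multiplicative_ext f g : multiplicative_fun f -> multiplicative_fun g ->
  (forall p k, prime p -> f (p ^ k)%N = g (p ^ k)%N) ->
  forall n, (0 < n)%N -> f n = g n.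
Proof.
move=> [f1 fM] [g1 gM] fg n; elim/ltn_ind: n => n IH n0.
have [n1|n1] := leqP n 1.
  by rewrite (_ : n = 1%N) ?f1 ?g1 //; apply/eqP; rewrite eqn_leq n1.
have pp := pdiv_prime n1; set p := pdiv n in pp.
have pn : (0 < logn p n)%N by rewrite logn_gt0 mem_primes pp n0 pdiv_dvd.
have [k [m [nE k0 m0 cop]]] : exists k m,
    [/\ n = (p ^ k * m)%N, (0 < k)%N, (0 < m)%N & coprime (p ^ k) m].
  exists (logn p n), (n`_p^')%N; rewrite -p_part partnC //.
  by split; rewrite ?part_gt0 // coprime_partC.
have pk1 : (1 < p ^ k)%N by rewrite -(exp1n k) ltn_exp2r // prime_gt1.
have pk0 := ltnW pk1.
by rewrite nE fM // gM // fg // IH // nE -[X in (X < _)%N]mul1n ltn_pmul2r.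
Qed.

End DirichletConvolution.

(** * The functions a and b *)

Section ArithB.

Implicit Types (p r j k n : nat).

Definition arith_b_local p r k : rat :=
  (-1) ^+ k * p%:R ^+ 'C(k, 2) * p_binomial p r k.

(** Factoring [p] out of each difference relates the numerator for [r.+1], [j.+1] to that for [r],
    [j]. The power of [p] with exponent [r - j] is written as a quotient so as to cover [j > r]. *)
Lemma p_binomial_pascal p r j : (1 < p)%N ->
  p_binomial p r.+1 j.+1 = p_binomial p r j.+1 + p%:R ^+ r / p%:R ^+ j * p_binomial p r j.
Proof.
move=> p1; have p0 : (p%:R : rat) != 0 by rewrite pnatr_eq0 -lt0n ltnW.
pose num r' j' : rat := \prod_(i < j') (p%:R ^+ r' - p%:R ^+ i).
have numS r' j' : num r' j'.+1 = num r' j' * (p%:R ^+ r' - p%:R ^+ j').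
  by rewrite /num big_ord_recr.
have numSS r' j' : num r'.+1 j'.+1 = (p%:R ^+ r'.+1 - 1) * p%:R ^+ j' * num r' j'.
  rewrite /num big_ord_recl /= expr0 -mulrA; congr (_ * _).
  rewrite -[in X in X * _](card_ord j') -prodr_const -big_split /=.
  by apply: eq_bigr => i _; rewrite mulrBr -!exprS.
have den0 j' : num j' j' != 0.
  apply/prodf_neq0 => i _; rewrite subr_eq0 -!natrX eqr_nat eqn_exp2l //.
  by rewrite gtn_eqF.
have pj0 j' : (p%:R ^+ j' : rat) != 0 by rewrite expf_neq0.
have pS1 : (p%:R ^+ j.+1 - 1 : rat) != 0.
  by have := den0 j.+1; rewrite numSS !mulf_eq0 !negb_or => /andP[/andP[]].
rewrite /p_binomial -/(num r.+1 j.+1) -/(num j.+1 j.+1) -/(num r j.+1) -/(num r j) -/(num j j).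
rewrite !numSS numS; move: pS1; rewrite !exprS => pS1.
have [D0 Q0] := (den0 j, pj0 j).
by field; rewrite D0 Q0 pS1.
Qed.

(** By the q-binomial theorem the generating series of [arith_b_local p r] in X is the product of
    the factors 1 - p^i X over i < r; this is multiplication by the next factor, read on
    coefficients. *)
Lemma arith_b_localS p r k : (1 < p)%N ->
  arith_b_local p r.+1 k.+1 = arith_b_local p r k.+1 - p%:R ^+ r * arith_b_local p r k.
Proof.
move=> p1; have p0 : (p%:R : rat) != 0 by rewrite pnatr_eq0 -lt0n ltnW.
rewrite /arith_b_local p_binomial_pascal // binS bin1 exprD !exprS.
have pk0 : (p%:R ^+ k : rat) != 0 by rewrite expf_neq0.
by field.
Qed.

Lemma arith_b_local0 p r : arith_b_local p r 0 = 1.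
Proof. by rewrite /arith_b_local /p_binomial !big_ord0 divr1 !mulr1. Qed.

Lemma arith_b_pfactor p r k : prime p -> arith_b r (p ^ k)%N = arith_b_local p r k.
Proof.
move=> pp; case: k => [|k]; first by rewrite arith_b_local0 /arith_b big_nil.
by rewrite /arith_b primesX // primes_prime // big_seq1 pfactorK.
Qed.

Lemma arith_b_multiplicative r : multiplicative_fun (arith_b r).
Proof.
split=> [|m n m0 n0 mn]; first by rewrite /arith_b big_nil.
have disj q : q \in primes m -> q \in primes n -> False.
  move=> qm qn; move: mn; rewrite coprime_has_primes // => /hasPn/(_ q qn).
  by rewrite /= qm.
have E : perm_eq (primes (m * n)) (primes m ++ primes n).
  apply: uniq_perm; rewrite ?primes_uniq ?cat_uniq ?primes_uniq //.
    by rewrite andbT -coprime_has_primes.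
  by move=> q; rewrite primesM // mem_cat.
have logn0 q a : q \notin primes a -> (0 < a)%N -> logn q a = 0%N.
  by move=> qa a0; apply/eqP; rewrite -leqn0 leqNgt logn_gt0.
rewrite /arith_b (perm_big _ E) big_cat /=; congr (_ * _); apply: eq_big_seq => q qP.
  by rewrite lognM // (logn0 q n) ?addn0 //; apply/negP => /(disj _ qP).
by rewrite lognM // (logn0 q m) //; apply/negP => /disj/(_ qP).
Qed.

Lemma arith_a_multiplicative : multiplicative_fun arith_a.
Proof.
split=> [|m n m0 n0 mn]; first by rewrite /arith_a expr2 mulrNN mulr1.
have no_both_even : odd m || odd n.
  apply: contraTT mn; rewrite negb_or -!dvdn2 => /andP[m2 n2].
  apply/negP => /eqP mn; have : (2 %| gcdn m n)%N by rewrite dvdn_gcd m2.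
  by rewrite mn.
rewrite /arith_a -signr_odd -[in RHS]signr_odd -[X in _ * X]signr_odd /= oddM.
by move: no_both_even; case: (odd m); case: (odd n); rewrite //= ?expr0 ?expr1 ?mulr1 ?mul1r.
Qed.

Lemma arith_b0 n : (0 < n)%N -> arith_b 0 n = (n == 1%N)%:R.
Proof.
move=> n0; have [->|n1] := eqVneq n 1%N; first by rewrite /arith_b big_nil.
have n2 : (1 < n)%N by rewrite ltn_neqAle eq_sym n1.
have pp : pdiv n \in primes n by rewrite mem_primes pdiv_prime // n0 pdiv_dvd.
rewrite /arith_b (big_rem _ pp) /=.
have : (0 < logn (pdiv n) n)%N by rewrite logn_gt0.
case: (logn _ _) => // k _.
(* For [r = 0] the first factor of the numerator is [p ^ 0 - p ^ 0]. *)
by rewrite /p_binomial big_ord_recl subrr !(mul0r, mulr0).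
Qed.

Lemma natX_multiplicative r : multiplicative_fun (fun n => n%:R ^+ r).
Proof. by split=> [|m n _ _ _]; rewrite ?expr1n // natrM exprMn. Qed.

Lemma arith_b_recurrence r n : (0 < n)%N ->
  arith_b r n = dirichlet_conv (arith_b r.+1) (fun n => n%:R ^+ r) n.
Proof.
apply: multiplicative_ext => [||p k pp]; first exact: arith_b_multiplicative.
  exact: dirichlet_conv_multiplicative (arith_b_multiplicative _) (natX_multiplicative _).
rewrite dirichlet_conv_pfactor // arith_b_pfactor //.
under eq_bigr do rewrite arith_b_pfactor // natrX.
elim: k => [|k IH]; first by rewrite big_ord1 subn0 !arith_b_local0 expr0 expr1n mulr1.
rewrite big_ord_recr /= subnn expr0 expr1n mulr1 arith_b_localS ?prime_gt1 //.
(* The terms [i <= k] are [p ^ r] times the sum for [k], known by induction; they cancel the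
   correction term of [arith_b_localS]. *)
rewrite (_ : \sum_(i < k.+1) _ = p%:R ^+ r * arith_b_local p r k); first by ring.
rewrite IH mulr_sumr; apply: eq_bigr => i _.
have ik : (i <= k)%N by rewrite -ltnS.
by rewrite subSn // exprS exprMn mulrCA.
Qed.

End ArithB.

(** * Equivariant Euler characteristics of partition lattices *)

Lemma sum_cons_family (gT : finGroupType) r (F : {set gT} -> int) :
  \sum_(X : {ffun 'I_r.+1 -> gT} | commuting_family X) F [set X i | i : 'I_r.+1] =
  \sum_(x : gT) \sum_(X : {ffun 'I_r -> gT} | centralizing_family x X) F (family_set x X).
Proof.
pose cons (u : gT * {ffun 'I_r -> gT}) : {ffun 'I_r.+1 -> gT} :=
  [ffun i => oapp u.2 u.1 (unlift ord0 i)].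
pose uncons (X : {ffun 'I_r.+1 -> gT}) := (X ord0, [ffun i => X (lift ord0 i)]).
have cons0 u : cons u ord0 = u.1 by rewrite ffunE unlift_none.
have consS u i : cons u (lift ord0 i) = u.2 i by rewrite ffunE liftK.
have consK : cancel cons uncons.
  by move=> [x X]; rewrite /uncons cons0; congr (_, _); apply/ffunP => i; rewrite ffunE consS.
have unconsK : cancel uncons cons.
  move=> X; apply/ffunP => i; rewrite ffunE; case: unliftP => [j ->|->] //=.
  by rewrite ffunE.
rewrite (reindex cons) /=; last by exists uncons => ? _; [apply: consK | apply: unconsK].
rewrite pair_big_dep /=; apply: eq_big => [[x X]|[x X] _] /=.
  apply/forallP/centralizing_familyP => [cX|[XX xX] i].
    split=> [i k|i].
      by have /forallP/(_ (lift ord0 k))/eqP := cX (lift ord0 i); rewrite !consS.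
    by have /forallP/(_ (lift ord0 i))/eqP := cX ord0; rewrite cons0 consS.
  apply/forallP => k; apply/eqP.
  case: (unliftP ord0 i) => [i' ->|->]; case: (unliftP ord0 k) => [k' ->|->];
    rewrite ?cons0 ?consS /=; [exact: XX | exact/commute_sym/xX | exact: xX | by []].
congr F; apply/setP => s; apply/imsetP/setU1P => [[i _ ->]|].
  by case: (unliftP ord0 i) => [j ->|->]; rewrite ?cons0 ?consS; [right; apply: imset_f | left].
case=> [->|/imsetP[i _ ->]]; first by exists ord0; rewrite ?cons0.
by exists (lift ord0 i); rewrite ?consS.
Qed.

(* [n / n! * sum of the Moebius numbers] for [n > 0], junk at [0]. *)
Definition moebius_mean r (n : nat) : rat :=
  if n is m.+1 then (m`!%:R)^-1 * (moebius_sum_commuting r (ord0 : 'I_m.+1))%:~R else 0.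

Lemma moebius_mean_recurrence r n : (0 < n)%N ->
  moebius_mean r n = dirichlet_conv (moebius_mean r.+1) (fun n => n%:R ^+ r) n.
Proof.
case: n => // m _; rewrite /dirichlet_conv big_divisors // /moebius_mean moebius_sum_recurrence card_ord.
rewrite mulr_sumr; apply: eq_bigr => d _.
rewrite /moebius_sum_centralizing -sum_cons_family -/(moebius_sum_commuting _ _).
have F0 k : (k`!%:R : rat) != 0 by rewrite pnatr_eq0 -lt0n fact_gt0.
have m0 : (m.+1%:R : rat) != 0 by rewrite pnatr_eq0.
rewrite factS natrM natrX.
move: (F0 m) (F0 d) m0; move: (m`!%:R) (d`!%:R) (m.+1%:R) => a b c a0 b0 c0.
by field; rewrite a0 b0 c0.
Qed.

(** The only family indexed by ['I_0] is the empty one, so this is the full partition lattice, whose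
    factorial cancels the normalization. *)
Lemma moebius_mean0 n : (0 < n)%N -> moebius_mean 0 n = arith_a n.
Proof.
case: n => // m _; rewrite /moebius_mean /moebius_sum_commuting.
rewrite (big_pred1 [ffun=> 1%g]) => [|X]; last first.
  rewrite /= /commuting_family; apply/forallP/eqP => [_|_ []//].
  by apply/ffunP; case.
rewrite (_ : [set _ | _ in _] = set0); last by apply/setP => s; rewrite inE; apply/negP => /imsetP[[]].
rewrite top_moebius_set0 card_ord /= intrM natz -pmulrn mulrCA.
rewrite mulVf ?mulr1 ?pnatr_eq0 -?lt0n ?fact_gt0 //.
by rewrite rmorphXn /= rmorphN1 /arith_a !exprS !mulN1r opprK.
Qed.

(** Both sides become the same function for [r] when convolved with the [r]-th power function, which
    can be cancelled since its value at 1 is 1. At [r = 0], [arith_b 0] is the convolution unit. *)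
Lemma moebius_meanE r n : (0 < n)%N ->
  moebius_mean r n = dirichlet_conv arith_a (arith_b r) n.
Proof.
elim: r n => [|r IH] n.
  move=> n0; rewrite moebius_mean0 // /dirichlet_conv big_divisors //.
  have n1 : (n.-1 < n)%N by rewrite prednK.
  rewrite (bigD1 (Ordinal n1)) /= ?prednK // divnn n0 arith_b0 // mulr1 big1 ?addr0 //.
  move=> d /andP[dn dn1]; rewrite arith_b0 ?divn_gt0 ?ltn_ord //.
  rewrite (_ : _ == _ = false) ?mulr0 //; apply: contraNF dn1 => /eqP nd.
  have := divnK dn; rewrite nd mul1n => dE.
  by apply/eqP/val_inj; rewrite /= -[X in X.-1]dE.
apply: (dirichlet_conv_cancel (g := fun n => n%:R ^+ r)); first by rewrite expr1n oner_eq0.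
move=> k k0; rewrite -moebius_mean_recurrence // IH // dirichlet_convA //.
by apply: eq_dirichlet_conv => // i i0; apply: arith_b_recurrence.
Qed.

Lemma eq_red_euler_char_moebius r m :
  eq_red_euler_char r.+1 (setpart_action 'I_m.+2) (proper_setparts 'I_m.+2) [set: 'S_m.+2]%G
  = (m.+2`!%:R)^-1 * (moebius_sum_commuting r.+1 (ord0 : 'I_m.+2))%:~R.
Proof.
rewrite /eq_red_euler_char cardsT card_Sn; congr (_ * _).
rewrite -rmorph_sum /= /moebius_sum_commuting; congr (_%:~R).
rewrite (reindex (fun X : {ffun 'I_r.+1 -> 'S_m.+2} => [tuple X i | i < r.+1])) /=; last first.
  exists (fun t => [ffun i => tnth t i]) => [X|t] _.
    by apply/ffunP => i; rewrite ffunE tnth_mktuple.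
  by apply: eq_from_tnth => i; rewrite tnth_mktuple ffunE.
apply: eq_big => [X|X _].
  rewrite inE; apply/andP/forallP => [[_ /forallP cX] i|cX].
    by apply/forallP => k; have /forallP/(_ k) := cX i; rewrite !tnth_mktuple.
  split; first by apply/forallP => i; rewrite inE.
  apply/forallP => i; apply/forallP => k; rewrite !tnth_mktuple.
  by have /forallP := cX i; apply.
have T1 : (1 < #|'I_m.+2|)%N by rewrite card_ord.
rewrite (red_euler_char_proper (ord0 : 'I_m.+2) _ T1).
suff -> : [set x in [tuple X i | i < r.+1]] = [set X i | i : 'I_r.+1] by [].
apply/setP => s; rewrite inE; apply/tnthP/imsetP => [[i ->]|[i _ ->]].
  by exists i; rewrite ?tnth_mktuple.
by exists i; rewrite tnth_mktuple.
Qed.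

Theorem theorem1p1 (n r : nat) (hn : (2 <= n)%N) (hr : (1 <= r)%N) :
  multiplicative_fun arith_a /\
  multiplicative_fun (arith_b r) /\
  eq_red_euler_char r (setpart_action 'I_n) (proper_setparts 'I_n) [set: 'S_n]%G
    = n%:R^-1 * dirichlet_conv arith_a (arith_b r) n.
Proof.
split; first exact: arith_a_multiplicative.
split; first exact: arith_b_multiplicative.
case: n hn => [|[|m]] // _; case: r hr => // r _.
rewrite eq_red_euler_char_moebius -moebius_meanE // /moebius_mean.
(* [moebius_mean] is [n] times the Euler characteristic, which accounts for the factor [1 / n]. *)
by rewrite factS natrM invfM -mulrA.
Qed.
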